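(* Let $M$ be a smooth manifold, $n:=\dim M$, and let $\nabla$ be any higher connection on $M$. Then there exist (i) a unique affine connection $\widetilde{\nabla}$ on $TM$, and (ii) a unique collection of sections $F^{k,l}$ of the bundles $E^{k,l}:=\wedge^{k+l-1}TM\otimes\wedge^kT^\ast M\otimes\wedge^lT^\ast M$, for $k,l>0$ with $k+l-1\le n$, such that $F^{1,1}\equiv 0$ and $$\nabla_XY=\widetilde{\nabla}_XY+F^{k,l}(X,Y)\qquad\text{for all }X\in A^k(M),\ Y\in A^l(M),$$ where $\widetilde{\nabla}_XY$ on the right-hand side denotes the induced higher connection associated with the affine connection $\widetilde{\nabla}$. Conversely, any affine connection $\widetilde{\nabla}$ on $TM$ together with any collection of sections $F^{k,l}\in\Gamma(E^{k,l})$, $k,l>0$, $k+l-1\le n$, with $F^{1,1}\equiv 0$, determines a unique higher connection on $M$ satisfying the displayed formula. In particular, there is a bijection between the space of all higher connections on $M$ and the set of all pairs $(\widetilde{\nabla},\{F^{k,l}\})$, where $\widetilde{\nabla}$ is an affine connection on $TM$ and $F^{k,l}\in\Gamma(E^{k,l})$ for $k,l>0$ with $k+l-1\le n$ and $F^{1,1}\equiv 0$.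
   Context: Multivector fields: $A^k(M):=\Gamma(\wedge^kTM)$ for $k\ge 0$ (so $A^0(M)=C^\infty(M)$), $A^k(M):=0$ for $k<0$, $\mathcal{A}(M):=\bigoplus_{k\ge0}A^k(M)$. Schouten–Nijenhuis bracket: the unique $\mathbb{R}$-bilinear map $[\cdot,\cdot]:A^k(M)\times A^l(M)\to A^{k+l-1}(M)$ such that $[f,g]=0$ for $f,g\in C^\infty(M)$; $[X,Q]=L_XQ$ (Lie derivative) for $X\in A^1(M)$; $[P,Q]=-(-1)^{(p-1)(q-1)}[Q,P]$ and $[P,Q\wedge R]=[P,Q]\wedge R+(-1)^{(p-1)q}Q\wedge[P,R]$ for $P\in A^p(M)$, $Q\in A^q(M)$, $R\in\mathcal{A}(M)$. A higher (affine) connection on $M$ is a map $\nabla:\mathcal{A}(M)\times\mathcal{A}(M)\to\mathcal{A}(M)$, $(X,Y)\mapsto\nabla_XY$, such that (i) $\nabla_XY\in A^{k+l-1}(M)$ for $X\in A^k(M)$, $Y\in A^l(M)$; (ii) $\nabla_{fX+X'}Y=f\nabla_XY+\nabla_{X'}Y$ for $f\in C^\infty(M)$; (iii) $\nabla_X(Y+Y')=\nabla_XY+\nabla_XY'$; (iv) $\nabla_Xf=[X,f]$ for $X\in A^k(M)$, $f\in C^\infty(M)$; (v) $\nabla_X(fY)=[X,f]\wedge Y+f\nabla_XY$ for $X\in A^k(M)$, $f\in C^\infty(M)$, $Y\in\mathcal{A}(M)$; (vi) $\nabla_fX=0$ for $f\in C^\infty(M)$. The induced higher connection associated with an affine connection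 $\widetilde{\nabla}$ on $TM$ is the unique higher connection, again denoted $\widetilde{\nabla}$, which agrees with the affine connection on $A^1(M)\times A^1(M)$ and satisfies $\widetilde{\nabla}_{X\wedge Y}Z=X\wedge\widetilde{\nabla}_YZ+(-1)^{kl}Y\wedge\widetilde{\nabla}_XZ$ and $\widetilde{\nabla}_X(Y\wedge Z)=(\widetilde{\nabla}_XY)\wedge Z+(-1)^{(k-1)l}Y\wedge\widetilde{\nabla}_XZ$ for $X\in A^k(M)$, $Y\in A^l(M)$, $Z\in\mathcal{A}(M)$. A section of $E^{k,l}$ is identified with a $C^\infty(M)$-bilinear map $A^k(M)\times A^l(M)\to A^{k+l-1}(M)$. *)

(* Defs.v *)
From HB Require Import structures.
From mathcomp Require Import all_boot all_order all_algebra.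
From mathcomp Require Import all_classical all_reals all_analysis.
Set Implicit Arguments.
Unset Strict Implicit.
Unset Printing Implicit Defensive.
Import Order.TTheory GRing.Theory Num.Theory.
Import numFieldNormedType.Exports.
Local Open Scope ring_scope.

Section ExteriorAlgebra.
Variables (R : realType) (n : nat).

(* The exterior algebra of R^n, by coordinates on the basis
   e_S = e_{i_1} /\ ... /\ e_{i_k} with S = {i_1 < ... < i_k}. *)
Definition ext := {ffun {set 'I_n} -> R^o}.

Definition ebas (S : {set 'I_n}) : ext := [ffun T => (T == S)%:R].

Definition inversions (A B : {set 'I_n}) : nat :=
  #|[set p : 'I_n * 'I_n | [&& p.1 \in A, p.2 \in B & (p.2 < p.1)%N]]|.

(* e_A /\ e_B = esign A B *: e_(A :|: B) *)
Definition esign (A B : {set 'I_n}) : R :=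
  if [disjoint A & B] then (-1) ^+ inversions A B else 0.

Definition wedge (u v : ext) : ext :=
  \sum_A \sum_B (u A * v B * esign A B) *: ebas (A :|: B).

Definition evec (v : 'rV[R]_n) : ext := \sum_i v 0 i *: ebas [set i].

(* [enum S] is increasing, so [wprod 1%:M S = ebas S]. *)
Definition wprod (J : 'M[R]_n) (S : {set 'I_n}) : ext :=
  \big[wedge/ebas finset.set0]_(i <- enum S) evec (row i J).

(* The algebra map induced by the linear map u |-> u *m J on row vectors. *)
Definition extmap (J : 'M[R]_n) (w : ext) : ext := \sum_S w S *: wprod J S.

(* Interior product of w with dx^i, a graded derivation from the left. *)
Definition contract (i : 'I_n) (w : ext) : ext :=
  [ffun T => esign [set i] T * w (i |: T)].

Implicit Types (A B C S : {set 'I_n}) (u v w : ext).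

Lemma inversions0l B : inversions finset.set0 B = 0%N.
Proof. by apply/eqP; rewrite cards_eq0; apply/eqP/setP=> p; rewrite !inE. Qed.

Lemma inversions0r A : inversions A finset.set0 = 0%N.
Proof. by apply/eqP; rewrite cards_eq0; apply/eqP/setP=> p; rewrite !inE andbF. Qed.

Lemma inversionsUl A B C : [disjoint A & B] ->
  inversions (A :|: B) C = (inversions A C + inversions B C)%N.
Proof.
move=> dAB; rewrite /inversions -cardsUI.
rewrite [X in (_ + X)%N]eq_card0 ?addn0.
  by congr #|pred_of_set _|; apply/setP=> p; rewrite !inE andb_orl.
move=> p; rewrite !inE; apply/negP => /andP[/and3P[pA _ _] /and3P[pB _ _]].
by move/pred0P/(_ p.1): dAB; rewrite /= pA pB.
Qed.

Lemma inversionsUr A B C : [disjoint B & C] ->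
  inversions A (B :|: C) = (inversions A B + inversions A C)%N.
Proof.
move=> dAB; rewrite /inversions -cardsUI.
rewrite [X in (_ + X)%N]eq_card0 ?addn0.
  by congr #|pred_of_set _|; apply/setP=> p; rewrite !inE andb_orl andb_orr.
move=> p; rewrite !inE; apply/negP => /andP[/and3P[_ pA _] /and3P[_ pB _]].
by move/pred0P/(_ p.2): dAB; rewrite /= pA pB.
Qed.

Lemma esign0l B : esign finset.set0 B = 1.
Proof.
rewrite /esign inversions0l expr0.
by rewrite -setI_eq0 finset.set0I eqxx.
Qed.

Lemma esignA A B C :
  esign A B * esign (A :|: B) C = esign A (B :|: C) * esign B C.
Proof.
rewrite /esign -!setI_eq0 finset.setIUl finset.setIUr !finset.setU_eq0.
case: eqP => [AB0|_] /=; last by rewrite mul0r; case: ifP; rewrite ?mul0r.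
case: eqP => [AC0|_] /=; last by rewrite mulr0 mul0r.
case: eqP => [BC0|_] /=; last by rewrite !mulr0.
rewrite -!exprD inversionsUl ?inversionsUr -?setI_eq0 ?AB0 ?BC0 //.
by rewrite addnA.
Qed.


Lemma wedge_linl a u v w : wedge (a *: u + v) w = a *: wedge u w + wedge v w.
Proof.
rewrite /wedge scaler_sumr -big_split; apply: eq_bigr => A _ /=.
rewrite scaler_sumr -big_split; apply: eq_bigr => B _ /=.
by rewrite !ffunE scalerA -scalerDl !mulrDl !mulrA.
Qed.

Lemma wedge_linr a u v w : wedge w (a *: u + v) = a *: wedge w u + wedge w v.
Proof.
rewrite /wedge scaler_sumr -big_split; apply: eq_bigr => A _ /=.
rewrite scaler_sumr -big_split; apply: eq_bigr => B _ /=.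
rewrite !ffunE scalerA -scalerDl mulrDr mulrDl; congr ((_ + _) *: _).
by rewrite mulrCA !mulrA.
Qed.

Lemma wedge0l w : wedge 0 w = 0.
Proof. by have := wedge_linl (-1) 0 0 w; rewrite scaler0 addr0 scaleN1r addNr. Qed.
Lemma wedge0r w : wedge w 0 = 0.
Proof. by have := wedge_linr (-1) 0 0 w; rewrite scaler0 addr0 scaleN1r addNr. Qed.
Lemma wedgeDl u v w : wedge (u + v) w = wedge u w + wedge v w.
Proof. by have := wedge_linl 1 u v w; rewrite !scale1r. Qed.
Lemma wedgeDr u v w : wedge w (u + v) = wedge w u + wedge w v.
Proof. by have := wedge_linr 1 u v w; rewrite !scale1r. Qed.
Lemma wedgeZl a u w : wedge (a *: u) w = a *: wedge u w.
Proof. by have := wedge_linl a u 0 w; rewrite wedge0l !addr0. Qed.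
Lemma wedgeZr a u w : wedge w (a *: u) = a *: wedge w u.
Proof. by have := wedge_linr a u 0 w; rewrite wedge0r !addr0. Qed.
Lemma wedge_suml (I : finType) (P : pred I) (F : I -> ext) w :
  wedge (\sum_(i | P i) F i) w = \sum_(i | P i) wedge (F i) w.
Proof. by apply: (big_morph (wedge^~ w)) => [u v|]; [exact: wedgeDl|exact: wedge0l]. Qed.
Lemma wedge_sumr (I : finType) (P : pred I) (F : I -> ext) w :
  wedge w (\sum_(i | P i) F i) = \sum_(i | P i) wedge w (F i).
Proof. by apply: (big_morph (wedge w)) => [u v|]; [exact: wedgeDr|exact: wedge0r]. Qed.

Lemma ext_sum u : u = \sum_S u S *: ebas S.
Proof.
apply/ffunP=> T; rewrite sum_ffunE (bigD1 T) //= big1 ?addr0.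
  by rewrite !ffunE eqxx [RHS]mulr1.
by move=> S ST; rewrite !ffunE eq_sym (negPf ST) [LHS]mulr0.
Qed.

Lemma wedge_ebas A B : wedge (ebas A) (ebas B) = esign A B *: ebas (A :|: B).
Proof.
rewrite /wedge (bigD1 A) //= [X in _ + X]big1 ?addr0; last first.
  by move=> C CA; rewrite big1 // => D _; rewrite !ffunE (negPf CA) !mul0r scale0r.
rewrite (bigD1 B) //= big1 ?addr0; last first.
  by move=> D DB; rewrite !ffunE (negPf DB) mulr0 !mul0r scale0r.
by rewrite !ffunE !eqxx !mul1r.
Qed.

Lemma wedge1l u : wedge (ebas finset.set0) u = u.
Proof.
rewrite {1}(ext_sum u) wedge_sumr [RHS]ext_sum; apply: eq_bigr => S _.
by rewrite wedgeZr wedge_ebas esign0l finset.set0U scale1r.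
Qed.

Lemma wedge_expl u w : wedge u w = \sum_A u A *: wedge (ebas A) w.
Proof. by rewrite {1}(ext_sum u) wedge_suml; apply: eq_bigr => A _; rewrite wedgeZl. Qed.
Lemma wedge_expr u w : wedge w u = \sum_A u A *: wedge w (ebas A).
Proof. by rewrite {1}(ext_sum u) wedge_sumr; apply: eq_bigr => A _; rewrite wedgeZr. Qed.

Lemma wedgeA u v w : wedge u (wedge v w) = wedge (wedge u v) w.
Proof.
have H A B C : wedge (ebas A) (wedge (ebas B) (ebas C)) =
               wedge (wedge (ebas A) (ebas B)) (ebas C).
  rewrite !wedge_ebas wedgeZl wedgeZr !wedge_ebas finset.setUA !scalerA.
  by rewrite esignA mulrC.
rewrite (wedge_expl u) (wedge_expl u v) wedge_suml; apply: eq_bigr => A _.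
rewrite wedgeZl; congr (_ *: _).
rewrite (wedge_expl v w) (wedge_expr v) wedge_suml wedge_sumr.
apply: eq_bigr => B _; rewrite wedgeZl wedgeZr; congr (_ *: _).
rewrite (wedge_expr w) [RHS]wedge_expr wedge_sumr; apply: eq_bigr => C _.
by rewrite wedgeZr H.
Qed.

Lemma inversions11 (x y : 'I_n) : inversions [set x] [set y] = (y < x)%N.
Proof.
rewrite /inversions; case: (ltnP y x) => yx.
  apply/eqP/cards1P; exists (x, y); apply/setP=> -[p q]; rewrite !inE /= xpair_eqE.
  by case: eqP => //= ->; case: eqP => //= ->.
  apply/eqP; rewrite cards_eq0; apply/eqP/setP=> -[p q]; rewrite !inE /=.
  by apply/negP=> /and3P[/eqP-> /eqP->]; rewrite ltnNge yx.
Qed.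

Lemma wedge_evec_anti (a b : 'rV[R]_n) : wedge (evec a) (evec b) = - wedge (evec b) (evec a).
Proof.
rewrite /evec !wedge_suml.
under eq_bigr do rewrite wedge_sumr.
under [in RHS]eq_bigr do rewrite wedge_sumr.
rewrite exchange_big -sumrN /=; apply: eq_bigr => j _; rewrite -sumrN.
apply: eq_bigr => i _; rewrite !(wedgeZl,wedgeZr) !wedge_ebas finset.setUC.
rewrite !scalerA -scaleNr; congr (_ *: _).
rewrite [b 0 j * _]mulrC -mulrN; congr (_ * _).
rewrite /esign !disjoints1 !inE eq_sym; case: eqP => [|/eqP ij]; rewrite ?oppr0 //=.
rewrite !inversions11 ltnNge leq_eqVlt.
have -> /= : (i == j :> nat) = false by apply: contraNF ij => /eqP/val_inj->.
by case: (i < j)%N; rewrite ?expr1 ?expr0 ?opprK.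
Qed.

Lemma wedge_evec_sq (a : 'rV[R]_n) : wedge (evec a) (evec a) = 0.
Proof.
have /eqP := wedge_evec_anti a a; rewrite -addr_eq0 -mulr2n -scaler_nat scaler_eq0.
by rewrite pnatr_eq0 => /eqP.
Qed.

Lemma enum_setU1 (m : 'I_n) S : (forall t, t \in S -> (m < t)%N) ->
  enum (m |: S) = m :: enum S.
Proof.
move=> mS.
have st (T : {set 'I_n}) : sorted (fun i j : 'I_n => (i < j)%N) (enum T).
  rewrite /(enum _) /= -enumT; apply: sorted_filter; first exact: ltn_trans.
  by have := iota_ltn_sorted 0 n; rewrite -val_enum_ord sorted_map.
apply: (@irr_sorted_eq _ (fun i j : 'I_n => (i < j)%N)) => //.
- exact: ltn_trans.
- by move=> i; exact: ltnn.
- rewrite /= path_min_sorted //; apply/allP=> t; rewrite mem_enum; exact: mS.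
- by move=> t; rewrite inE !mem_enum !inE.
Qed.

Lemma wprodU1 J (m : 'I_n) S : (forall t, t \in S -> (m < t)%N) ->
  wprod J (m |: S) = wedge (evec (row m J)) (wprod J S).
Proof. by move=> mS; rewrite /wprod enum_setU1 // big_cons. Qed.

Lemma esign_lt (m : 'I_n) S : (forall t, t \in S -> (m < t)%N) -> esign [set m] S = 1.
Proof.
move=> mS; rewrite /esign disjoints1; case: ifPn => [_|/negPn /mS]; last by rewrite ltnn.
rewrite (_ : inversions _ _ = 0%N) //.
apply/eqP; rewrite cards_eq0; apply/eqP/setP=> -[p q]; rewrite !inE /=.
apply/negP=> /and3P[/eqP-> /mS]; rewrite ltnNge => /negP + pq; apply.
exact: ltnW.
Qed.

Lemma wedge_wprod1 J (a : 'I_n) S :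
  wedge (evec (row a J)) (wprod J S) = esign [set a] S *: wprod J (a |: S).
Proof.
have [k] := ubnP #|S|; elim: k S => // k IH S.
have [->|[s sS]] := set_0Vmem S.
  move=> _; rewrite wprodU1; last by move=> t; rewrite inE.
  by rewrite esign_lt ?scale1r // => t; rewrite inE.
rewrite ltnS => Sk.
have [m mS mle] : exists2 m, m \in S & forall t, t \in S -> (m <= t)%N.
  by case: (@arg_minnP _ s (mem S) val sS) => m; exists m.
have m' t : t \in S :\ m -> (m < t)%N.
  rewrite in_setD1 => /andP[tm /mle]; rewrite leq_eqVlt => /orP[/eqP/val_inj mt|//].
  by rewrite mt eqxx in tm.
have [am|ma|/val_inj am] := ltngtP a m.
- have aS t : t \in S -> (a < t)%N by move=> /mle; exact: leq_trans.
  by rewrite wprodU1 // esign_lt // scale1r.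
- have S'k : (#|S :\ m| < k)%N by move: Sk; rewrite (cardsD1 m S) mS.
  have -> : wprod J S = wedge (evec (row m J)) (wprod J (S :\ m)).
    by rewrite -wprodU1 // finset.setD1K.
  rewrite wedgeA wedge_evec_anti -scaleN1r wedgeZl -wedgeA IH // wedgeZr.
  rewrite -wprodU1; last by move=> t; rewrite in_setU1 => /predU1P[->|/m'].
  rewrite finset.setUCA finset.setD1K // scalerA; congr (_ *: _).
  have am : a != m by apply: contraTneq ma => ->; rewrite ltnn.
  rewrite /esign !disjoints1 in_setD1 am /=; case: ifP => _; last by rewrite mulr0.
  rewrite -[in RHS](finset.setD1K mS) inversionsUr ?disjoints1 ?in_setD1 ?eqxx //.
  by rewrite inversions11 ma exprD expr1.
- have -> : wprod J S = wedge (evec (row m J)) (wprod J (S :\ m)).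
    by rewrite -wprodU1 // finset.setD1K.
  by rewrite am wedgeA wedge_evec_sq wedge0l /esign disjoints1 mS scale0r.
Qed.

Lemma wedge_wprod J A B :
  wedge (wprod J A) (wprod J B) = esign A B *: wprod J (A :|: B).
Proof.
have [k] := ubnP #|A|; elim: k A => // k IH A.
have [->|[a aA]] := set_0Vmem A.
  by rewrite esign0l finset.set0U scale1r /wprod -[enum _]/(enum finset.set0) enum_set0 big_nil wedge1l.
rewrite (cardsD1 a A) aA ltnS => Ak.
have aA' : a \notin A :\ a by rewrite !inE eqxx.
have s2 : esign [set a] (A :\ a) * esign [set a] (A :\ a) = 1.
  by rewrite /esign disjoints1 aA' -expr2 sqrr_sign.
have -> : wprod J A = esign [set a] (A :\ a) *: wedge (evec (row a J)) (wprod J (A :\ a)).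
  by rewrite wedge_wprod1 scalerA s2 scale1r finset.setD1K.
rewrite wedgeZl -wedgeA IH // wedgeZr wedge_wprod1 !scalerA finset.setUA finset.setD1K //.
congr (_ *: _); rewrite -mulrA [esign (A :\ a) B * _]mulrC -esignA finset.setD1K //.
by rewrite mulrA s2 mul1r.
Qed.

Lemma extmap_lin J a u v : extmap J (a *: u + v) = a *: extmap J u + extmap J v.
Proof.
rewrite /extmap scaler_sumr -big_split; apply: eq_bigr => S _ /=.
by rewrite !ffunE scalerA -scalerDl.
Qed.

Lemma extmap0 J : extmap J 0 = 0.
Proof. by rewrite /extmap big1 // => S _; rewrite ffunE scale0r. Qed.

Lemma extmapD J u v : extmap J (u + v) = extmap J u + extmap J v.
Proof. by have := extmap_lin J 1 u v; rewrite !scale1r. Qed.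

Lemma extmapZ J a u : extmap J (a *: u) = a *: extmap J u.
Proof. by have := extmap_lin J a u 0; rewrite extmap0 !addr0. Qed.

Lemma extmap_ebas J S : extmap J (ebas S) = wprod J S.
Proof.
rewrite /extmap (bigD1 S) //= big1 ?addr0 => [|T TS].
  by rewrite ffunE eqxx scale1r.
by rewrite ffunE (negPf TS) scale0r.
Qed.

Lemma extmap_sum J (I : finType) (F : I -> ext) :
  extmap J (\sum_i F i) = \sum_i extmap J (F i).
Proof. by apply: (big_morph (extmap J)) => [u v|]; [exact: extmapD|exact: extmap0]. Qed.

Lemma extmap_wedge J u v : extmap J (wedge u v) = wedge (extmap J u) (extmap J v).
Proof.
rewrite {1}/wedge extmap_sum [in RHS]/extmap wedge_suml; apply: eq_bigr => A _.
rewrite extmap_sum wedge_sumr; apply: eq_bigr => B _.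
rewrite extmapZ extmap_ebas wedgeZl wedgeZr wedge_wprod !scalerA.
by [].
Qed.

End ExteriorAlgebra.

Local Open Scope classical_set_scope.

Section SmoothFunctions.
Variables (R : realType) (n : nat).
Implicit Types (V : set 'rV[R]_n) (f g : 'rV[R]_n -> R).

Definition unitv (i : 'I_n) : 'rV[R]_n := delta_mx 0 i.

(* V is meant to be open: partial derivatives at points of V then depend on
   the restriction of f to V only. *)
Fixpoint Ck (k : nat) V f : Prop :=
  (forall x, V x -> {for x, continuous f}) /\
  match k with
  | 0 => True
  | k'.+1 => forall i, (forall x, V x -> derivable f x (unitv i)) /\
                       Ck k' V ('D_(unitv i) f)
  end.

Definition smooth_on V f : Prop := forall k, Ck k V f.

Lemma eq_Ck k V f g : open V -> (forall x, V x -> f x = g x) -> Ck k V f -> Ck k V g.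
Proof.
move=> oV; elim: k f g => [|k IH] f g fg /= [cf Df].
all: have nfg x : V x -> \forall y \near x, f y = g y by
  move=> Vx; apply: filterS (open_nbhs_nbhs (conj oV Vx)) => y; exact: fg.
all: have cg x : V x -> {for x, continuous g} by
  move=> Vx; rewrite /prop_for /continuous_at -fg //; exact: (cvg_trans (near_eq_cvg (nfg x Vx)) (cf x Vx)).
- by split.
- split=> // i; have [df Dk] := Df i; split.
    by move=> x Vx; apply: near_eq_derivable (df x Vx); exact: nfg.
  apply: IH Dk => x Vx; apply: near_eq_derive; exact: nfg.
Qed.

Lemma CkS k V f : Ck k.+1 V f -> Ck k V f.
Proof.
elim: k f => [|k IH] f [cf Df]; first by split.
by split=> // i; have [df Dk] := Df i; split=> //; exact: IH.
Qed.

Lemma Ck_cst k V (a : R) : Ck k V (fun=> a).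
Proof.
elim: k a => [|k IH] a /=; (split=> [x _|]; first exact: (@cvg_cst R a 'rV[R]_n (nbhs x) (nbhs_filter x))) => //.
move=> i; split; first by move=> x _; exact: derivable_cst.
have -> : 'D_(unitv i) (fun=> a) = (fun=> 0 : R) :> ('rV[R]_n -> R).
  by apply/funext=> x; rewrite derive_cst.
exact: IH.
Qed.

Lemma Ck_add k V f g : open V -> Ck k V f -> Ck k V g -> Ck k V (f + g).
Proof.
move=> oV; elim: k f g => [|k IH] f g /= [cf Df] [cg Dg].
  by split=> // x Vx; exact: (cvgD (cf x Vx) (cg x Vx)).
split=> [x Vx|i]; first exact: (cvgD (cf x Vx) (cg x Vx)).
have [df Dkf] := Df i; have [dg Dkg] := Dg i; split.
  by move=> x Vx; apply: derivableD; [exact: df|exact: dg].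
apply: (@eq_Ck _ _ ('D_(unitv i) f + 'D_(unitv i) g)) => //; last exact: IH.
by move=> x Vx; rewrite deriveD //; [exact: df|exact: dg].
Qed.

Lemma Ck_mul k V f g : open V -> Ck k V f -> Ck k V g ->
  Ck k V (fun x => f x * g x).
Proof.
move=> oV; elim: k f g => [|k IH] f g.
  by move=> [cf _] [cg _]; split=> // x Vx; exact: (cvgM (cf x Vx) (cg x Vx)).
move=> Ckf Ckg; have [cf Df] := Ckf; have [cg Dg] := Ckg.
split=> [x Vx|i]; first exact: (cvgM (cf x Vx) (cg x Vx)).
have [df Dkf] := Df i; have [dg Dkg] := Dg i; split.
  by move=> x Vx; apply: derivableM; [exact: df|exact: dg].
apply: (@eq_Ck _ _ ((fun x => f x * 'D_(unitv i) g x) +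
                    (fun x => g x * 'D_(unitv i) f x))) => //.
  by move=> x Vx; rewrite deriveM //; [exact: df|exact: dg].
by apply: Ck_add => //; apply: IH => //; exact: CkS.
Qed.

Lemma smooth_on_cst V (a : R) : smooth_on V (fun=> a).
Proof. by move=> k; exact: Ck_cst. Qed.

Lemma smooth_onD V f g : open V -> smooth_on V f -> smooth_on V g ->
  smooth_on V (fun x => f x + g x).
Proof. by move=> oV sf sg k; exact: Ck_add. Qed.

Lemma smooth_onM V f g : open V -> smooth_on V f -> smooth_on V g ->
  smooth_on V (fun x => f x * g x).
Proof. by move=> oV sf sg k; exact: Ck_mul. Qed.

Lemma smooth_on_sum V (I : finType) (F : I -> 'rV[R]_n -> R) : open V ->
  (forall i, smooth_on V (F i)) -> smooth_on V (fun x => \sum_i F i x).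
Proof.
move=> oV sF.
suff H (r : seq I) : smooth_on V (fun x => \sum_(i <- r) F i x) by exact: H.
elim: r => [|i r IH].
  by under eq_fun do rewrite big_nil; exact: smooth_on_cst.
by under eq_fun do rewrite big_cons; exact: smooth_onD.
Qed.
End SmoothFunctions.

Section Manifold.
Variables (R : realType) (n : nat).

Record chart (T : topologicalType) := Chart {
  chart_dom : set T;
  coord : T -> 'rV[R]_n;
  chart_inv : 'rV[R]_n -> T;
  chart_dom_open : open chart_dom;
  chart_cod_open : open (coord @` chart_dom);
  coordK : forall x, chart_dom x -> chart_inv (coord x) = x;
  coord_continuous : forall x, chart_dom x -> {for x, continuous coord};
  chart_inv_continuous :
    forall x, chart_dom x -> {for coord x, continuous chart_inv} }.

Definition smooth_transition (T : topologicalType) (a b : chart T) : Prop :=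
  forall j, smooth_on (coord a @` (chart_dom a `&` chart_dom b))
                      (fun y => coord b (chart_inv a y) 0 j).

(* Any smooth atlas is allowed: it generates the maximal one, and the notions
   below do not depend on the choice of an atlas in its class. *)
Record smoothManifold := SmoothManifold {
  carrier :> topologicalType;
  manifold_hausdorff : hausdorff_space carrier;
  manifold_second_countable : @second_countable carrier;
  atlas : set (chart carrier);
  atlas_cover : forall x, exists2 c, atlas c & chart_dom c x;
  atlas_compatible :
    forall a b, atlas a -> atlas b -> smooth_transition a b }.

Variable M : smoothManifold.

Definition chart_at (x : M) : chart M := s2val (cid2 (atlas_cover x)).

Lemma chart_at_atlas x : atlas (chart_at x).
Proof. exact: (s2valP (cid2 (atlas_cover x))). Qed.

Lemma chart_at_dom x : chart_dom (chart_at x) x.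
Proof. exact: (s2valP' (cid2 (atlas_cover x))). Qed.

(* T_xM is identified with R^n by means of [chart_at x], and its exterior
   algebra with [ext R n]; the coordinates of a tangent vector at x in another
   chart b are obtained by applying the differential at x of the change of
   coordinates from [chart_at x] to b.  A (not necessarily smooth) section of
   the bundle /\TM is thus a map M -> ext R n. *)
Definition tcoord_change (x : M) (b : chart M) : 'M[R]_n :=
  'J (fun y => coord b (chart_inv (chart_at x) y)) (coord (chart_at x) x).

Definition local_rep (b : chart M) (X : M -> ext R n) (y : 'rV[R]_n) : ext R n :=
  extmap (tcoord_change (chart_inv b y) b) (X (chart_inv b y)).

Definition smooth_section (X : M -> ext R n) : Prop :=
  forall b, atlas b ->
  forall S, smooth_on (coord b @` chart_dom b) (fun y => local_rep b X y S).

Lemma smooth_section_wedge X Y : smooth_section X -> smooth_section Y ->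
  smooth_section (fun x => wedge (X x) (Y x)).
Proof.
move=> sX sY b Ab S; have oV : open (coord b @` chart_dom b) := @chart_cod_open _ b.
rewrite (_ : (fun y => _) = fun y => \sum_A \sum_B
   local_rep b X y A * local_rep b Y y B * (esign R A B * ebas R (A :|: B) S)).
  apply: smooth_on_sum => // A; apply: smooth_on_sum => // B.
  apply: smooth_onM => //; last exact: smooth_on_cst.
  by apply: smooth_onM => //; [exact: sX|exact: sY].
apply/funext => y; rewrite /local_rep extmap_wedge /wedge sum_ffunE.
apply: eq_bigr => A _; rewrite sum_ffunE; apply: eq_bigr => B _.
by rewrite [LHS]ffunE; symmetry; exact: mulrA.
Qed.

Definition smooth_section_pred : {pred M -> ext R n} :=
  [pred X | `[< smooth_section X >]].

Lemma smooth_section_submod_closed : submod_closed smooth_section_pred.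
Proof.
split=> [|a X Y /asboolP sX /asboolP sY]; apply/asboolP => b Ab S.
  rewrite (_ : (fun y => _) = fun=> 0); first exact: smooth_on_cst.
  by apply/funext => y; rewrite /local_rep extmap0 ffunE.
have oV : open (coord b @` chart_dom b) := @chart_cod_open _ b.
rewrite (_ : (fun y => _) =
  fun y => a * local_rep b X y S + local_rep b Y y S).
  apply: smooth_onD => //; last exact: sY.
  by apply: smooth_onM => //; [exact: smooth_on_cst|exact: sX].
by apply/funext => y; rewrite /local_rep extmap_lin !ffunE.
Qed.

HB.instance Definition _ := GRing.isSubmodClosed.Build R (M -> ext R n)
  smooth_section_pred smooth_section_submod_closed.

(* The space A(M) of smooth sections of /\TM. *)
Record mvfield := MVField {
  mvfield_val :> M -> ext R n;
  mvfieldP : mvfield_val \in smooth_section_pred }.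

HB.instance Definition _ := [isSub for mvfield_val].
HB.instance Definition _ := [Choice of mvfield by <:].
HB.instance Definition _ := [SubChoice_isSubLmodule of mvfield by <:].

Lemma mwedge_subproof (X Y : mvfield) :
  (fun x => wedge (X x) (Y x)) \in smooth_section_pred.
Proof.
by apply/asboolP/smooth_section_wedge; apply/asboolP; exact: mvfieldP.
Qed.

Definition mwedge (X Y : mvfield) : mvfield := MVField (mwedge_subproof X Y).

(* The index is an integer, so that A^k(M) = 0 for k < 0. *)
Definition homogeneous (k : int) : {pred mvfield} :=
  [pred X : mvfield | `[< forall x (S : {set 'I_n}), #|S|%:Z != k -> X x S = 0 >]].

Lemma homogeneous_submod_closed k : submod_closed (homogeneous k).
Proof.
split=> [|a X Y /asboolP hX /asboolP hY]; apply/asboolP => x S Sk.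
  by rewrite [LHS]ffunE.
have -> : (a *: X + Y) x S = a * X x S + Y x S by rewrite [LHS]ffunE [Z in Z + _]ffunE.
by rewrite hX // hY // mulr0 addr0.
Qed.

HB.instance Definition _ (k : int) := GRing.isSubmodClosed.Build R mvfield
  (homogeneous k) (homogeneous_submod_closed k).

(* The space A^k(M); in particular [Ak 0] is C^oo(M), a function f being
   identified with the section x |-> f x *: ebas finset.set0. *)
Record Ak (k : int) := MkAk {
  Ak_val :> mvfield;
  AkP : Ak_val \in homogeneous k }.

HB.instance Definition _ (k : int) := [isSub for @Ak_val k].
HB.instance Definition _ (k : int) := [Choice of Ak k by <:].
HB.instance Definition _ (k : int) := [SubChoice_isSubLmodule of Ak k by <:].

Lemma fscale_subproof (k : int) (f : Ak 0) (X : Ak k) :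
  mwedge f X \in homogeneous k.
Proof.
have /asboolP hf := AkP f; have /asboolP hX := AkP X.
apply/asboolP => x S Sk; rewrite sum_ffunE big1 // => A _.
rewrite sum_ffunE big1 // => B _; rewrite !ffunE.
have [A0|A0] := eqVneq A finset.set0; last first.
  by rewrite hf ?mul0r ?[LHS]mul0r // eqz_nat cards_eq0.
rewrite A0 finset.set0U; have [SB|_] := eqVneq S B; last by rewrite [LHS]mulr0.
by rewrite hX -?SB // mulr0 mul0r [LHS]mul0r.
Qed.

Definition fscale (k : int) (f : Ak 0) (X : Ak k) : Ak k :=
  MkAk (fscale_subproof f X).

Definition pderiv (j : 'I_n) (g : 'rV[R]_n -> ext R n) (y : 'rV[R]_n) : ext R n :=
  [ffun S => 'D_(unitv R j) (fun z => g z S) y].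

(* Lie derivative of Q along the vector field X, in the coordinates of
   [chart_at x]:
     L_X Q = X^j d_j Q - (d_i X^j) e_j /\ (dx^i _| Q),
   that is X^j d_j Q^{i_1 ... i_k} minus the sum over r of
   Q^{i_1 ... j ... i_k} d_j X^{i_r} (j in position r). *)
Definition lie (X Q : mvfield) (x : M) : ext R n :=
  let c := chart_at x in
  let y := coord c x in
  let Xc := local_rep c X in
  let Qc := local_rep c Q in
  \sum_j Xc y [set j]%SET *: pderiv j Qc y
  - \sum_i \sum_j pderiv i Xc y [set j]%SET
                  *: wedge (ebas R [set j]) (contract i (Qc y)).

Definition sgn (e : int) : R := (-1) ^ e.

(* These properties determine the Schouten-Nijenhuis bracket uniquely. *)
Record schouten_bracket (br : mvfield -> mvfield -> mvfield) : Prop := {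
  schouten_linl : forall (a : R) X X' Y,
    br (a *: X + X') Y = a *: br X Y + br X' Y;
  schouten_linr : forall (a : R) X Y Y',
    br X (a *: Y + Y') = a *: br X Y + br X Y';
  schouten_degree : forall (k l : nat) (X : Ak k) (Y : Ak l),
    br X Y \in homogeneous (k%:Z + l%:Z - 1);
  schouten_fun : forall f g : Ak 0, br f g = 0;
  schouten_lie : forall (X : Ak 1) (Q : mvfield) x, br X Q x = lie X Q x;
  schouten_anti : forall (p q : nat) (P : Ak p) (Q : Ak q),
    br P Q = - (sgn ((p%:Z - 1) * (q%:Z - 1)) *: br Q P);
  schouten_leibniz : forall (p q : nat) (P : Ak p) (Q : Ak q) (S : mvfield),
    br P (mwedge Q S) =
    mwedge (br P Q) S + sgn ((p%:Z - 1) * q%:Z) *: mwedge Q (br P S) }.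

Record is_higher_connection (br nabla : mvfield -> mvfield -> mvfield) : Prop := {
  hc_degree : forall (k l : nat) (X : Ak k) (Y : Ak l),
    nabla X Y \in homogeneous (k%:Z + l%:Z - 1);
  hc_linl : forall (f : Ak 0) X X' Y,
    nabla (mwedge f X + X') Y = mwedge f (nabla X Y) + nabla X' Y;
  hc_addr : forall X Y Y', nabla X (Y + Y') = nabla X Y + nabla X Y';
  hc_fun : forall (k : nat) (X : Ak k) (f : Ak 0), nabla X f = br X f;
  hc_leibniz : forall (k : nat) (X : Ak k) (f : Ak 0) (Y : mvfield),
    nabla X (mwedge f Y) = mwedge (br X f) Y + mwedge f (nabla X Y);
  hc_fun0 : forall (f : Ak 0) (X : mvfield), nabla f X = 0 }.

Record higher_connection (br : mvfield -> mvfield -> mvfield) := HigherConnection {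
  hc_val :> mvfield -> mvfield -> mvfield;
  hcP : is_higher_connection br hc_val }.

Record affine_connection := AffineConnection {
  affine_val :> Ak 1 -> Ak 1 -> Ak 1;
  affine_linl : forall (f : Ak 0) (X X' Y : Ak 1),
    affine_val (fscale f X + X') Y = fscale f (affine_val X Y) + affine_val X' Y;
  affine_addr : forall X Y Y' : Ak 1,
    affine_val X (Y + Y') = affine_val X Y + affine_val X Y';
  affine_leibniz : forall (f : Ak 0) (X Y : Ak 1) x,
    affine_val X (fscale f Y) x =
    wedge (lie X f x) (Y x) + fscale f (affine_val X Y) x }.

Record induced_connection (br : mvfield -> mvfield -> mvfield)
    (A : affine_connection) (D : mvfield -> mvfield -> mvfield) : Prop := {
  induced_hc : is_higher_connection br D;
  induced_agree : forall X Y : Ak 1, D X Y = A X Y;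
  induced_wedgel : forall (k l : nat) (X : Ak k) (Y : Ak l) (Z : mvfield),
    D (mwedge X Y) Z = mwedge X (D Y Z) + sgn (k%:Z * l%:Z) *: mwedge Y (D X Z);
  induced_wedger : forall (k l : nat) (X : Ak k) (Y : Ak l) (Z : mvfield),
    D X (mwedge Y Z) =
    mwedge (D X Y) Z + sgn ((k%:Z - 1) * l%:Z) *: mwedge Y (D X Z) }.

(* Smooth sections of E^{k,l} = /\^{k+l-1}TM (x) /\^kT*M (x) /\^lT*M, as
   C^oo(M)-bilinear maps A^k(M) x A^l(M) -> A^{k+l-1}(M). *)
Record Esection (k l : nat) := ESection {
  Esection_val :> Ak k -> Ak l -> Ak (k%:Z + l%:Z - 1);
  Esection_linl : forall (f : Ak 0) (X X' : Ak k) (Y : Ak l),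
    Esection_val (fscale f X + X') Y =
    fscale f (Esection_val X Y) + Esection_val X' Y;
  Esection_linr : forall (f : Ak 0) (X : Ak k) (Y Y' : Ak l),
    Esection_val X (fscale f Y + Y') =
    fscale f (Esection_val X Y) + Esection_val X Y' }.

Definition admissible (k l : nat) : bool :=
  [&& 0 < k, 0 < l & k + l - 1 <= n]%N.

Definition Efamily := forall k l : nat, admissible k l -> Esection k l.

Definition F11_zero (F : Efamily) : Prop :=
  forall (h : admissible 1 1) X Y, F 1%N 1%N h X Y = 0.

(* For k = 0 or l = 0 there is no F^{k,l}, and for k + l - 1 > n the bundle
   E^{k,l} is zero: no correction term occurs in these degrees. *)
Definition decomposition (br nabla : mvfield -> mvfield -> mvfield)
    (A : affine_connection) (F : Efamily) : Prop :=
  exists2 D, induced_connection br A D &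
    forall (k l : nat) (X : Ak k) (Y : Ak l),
      (forall h : admissible k l, nabla X Y = D X Y + F k l h X Y) /\
      (~~ admissible k l -> nabla X Y = D X Y).

Definition connection_data : Type :=
  {p : affine_connection * Efamily | F11_zero p.2}.

End Manifold.

(* Main.v *)
Require Import Defs.
From HB Require Import structures.
From mathcomp Require Import all_boot all_order all_algebra.
From mathcomp Require Import all_classical all_reals all_analysis.
From mathcomp Require Import ring zify.
Set Implicit Arguments.
Unset Strict Implicit.
Unset Printing Implicit Defensive.
Import Order.TTheory GRing.Theory Num.Theory.
Import numFieldNormedType.Exports.
Local Open Scope ring_scope.

(* A derivation-like operator on multivector fields is determined by its values on
   functions and vector fields, because by Euler's identity
     sum_i E_i /\ (dx^i _| X) = k X   for X of degree k
   (multiplied by a bump function, so that everything is globally defined) every X of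
   degree k > 1 is locally a sum of products of fields of lower degree.  This gives
   uniqueness of the induced higher connection, pointwise.  For existence, near each
   point the induced connection is, for X of degree k,
     nabla_X Z = (-1)^(k-1) sum_i (dx^i _| X) /\ nabla_(E_i) Z,
     nabla_(E_i) Z = [E_i, Z] + sum_j (nabla_(E_i) E_j - [E_i, E_j]) /\ (dx^j _| Z),
   and these local fields agree on overlaps by uniqueness.  The difference of a higher
   connection and the induced one is C^oo-bilinear, which is the decomposition. *)

(** * The exterior algebra *)

(** The axioms involve only globally defined fields, so an operator cannot simply be restricted to a
    chart and tested on coordinate fields. A [frame] therefore consists of global objects obeying
    the frame identities up to a bump function, and the rules of an induced connection are read at a
    single point y where that function is 1. Uniqueness is then a statement about each point
    separately, no locality of the operators having to be established beforehand, and existence may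
    choose an unrelated frame at every point. The price is paid in making these global objects
    smooth. Cutting off a coordinate expression and extending it by zero requires a smooth bump
    function, the chain rule for Jacobians, since tangent vectors are stored in a reference chart
    that may jump from point to point, and the Hausdorff property, which makes the image of a closed
    coordinate ball closed in M. The correction terms are tensorial because all higher connections
    share the derivative term [X, f] /\ Y. The normalisation F^{1,1} = 0 pins the affine connection
    down: it must be the restriction to vector fields. *)

Section ExteriorAlgebraFacts.
Variables (R : realType) (n : nat).
Notation ext := (ext R n).
Notation contract := (@Defs.contract R n).
Implicit Types (A B S T : {set 'I_n}) (u v w : ext) (J K : 'M[R]_n).

(** Peeling off the least element matches the increasing order behind [ebas] and [wprod]: adjoining
    m on the left then costs no sign. *)
Lemma set_ltn_ind (P : {set 'I_n} -> Prop) : P finset.set0 ->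
  (forall (m : 'I_n) S, (forall t, t \in S -> (m < t)%N) -> P S -> P (m |: S)) -> forall S, P S.
Proof.
move=> P0 PU S; have [k] := ubnP #|S|; elim: k S => // k IH S.
have [->//|[s sS]] := set_0Vmem S.
have [m mS mle] : exists2 m, m \in S & forall t, t \in S -> (m <= t)%N.
  by case: (@arg_minnP _ s (mem S) val sS) => m; exists m.
rewrite (cardsD1 m S) mS ltnS => Sk; rewrite -(finset.setD1K mS).
apply: PU; last exact: IH.
move=> t; rewrite in_setD1 => /andP[tm /mle]; rewrite leq_eqVlt.
by case/predU1P => [/val_inj mt|//]; rewrite mt eqxx in tm.
Qed.

Lemma esign0r A : esign R A finset.set0 = 1.
Proof. by rewrite /esign inversions0r expr0 -setI_eq0 finset.setI0 eqxx. Qed.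

Lemma wedge1r u : wedge u (ebas R finset.set0) = u.
Proof.
rewrite {1}(ext_sum u) wedge_suml [RHS]ext_sum; apply: eq_bigr => S _.
by rewrite wedgeZl wedge_ebas esign0r finset.setU0 scale1r.
Qed.

Lemma evec_row1 (i : 'I_n) : evec (row i 1%:M) = ebas R [set i].
Proof.
rewrite /evec (bigD1 i) //= big1 ?addr0 => [|j ji].
  by rewrite !mxE eqxx scale1r.
by rewrite !mxE eq_sym (negPf ji) scale0r.
Qed.

(** The exterior algebra is generated by its unit and degree one, so an algebra map is fixed there.
    This gives functoriality of [extmap], on which the changes of charts rest. *)
Lemma extmap_unique J (F : ext -> ext) :
  (forall a u v, F (a *: u + v) = a *: F u + F v) ->
  (forall u v, F (wedge u v) = wedge (F u) (F v)) ->
  F (ebas R finset.set0) = ebas R finset.set0 ->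
  (forall i, F (ebas R [set i]) = evec (row i J)) -> F =1 extmap J.
Proof.
move=> Flin Fw F1 Fi w.
have FB S : F (ebas R S) = wprod J S.
  elim/set_ltn_ind: S => [|m S mS IH].
    by rewrite F1 /wprod -[enum _]/(enum finset.set0) enum_set0 big_nil.
  rewrite wprodU1 // -IH -Fi -Fw wedge_ebas esign_lt // scale1r.
  by congr (F (ebas _ _)).
have F0 : F 0 = 0 by have := Flin (-1) 0 0; rewrite scaler0 addr0 scaleN1r addNr.
have FD u v : F (u + v) = F u + F v by have := Flin 1 u v; rewrite !scale1r.
have FZ a u : F (a *: u) = a *: F u by have := Flin a u 0; rewrite F0 !addr0.
rewrite {1}(ext_sum w) (big_morph F FD F0); apply: eq_bigr => S _.
by rewrite FZ FB.
Qed.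

Lemma extmap1 w : extmap 1%:M w = w.
Proof.
by symmetry; apply: (@extmap_unique 1%:M id) => // i; rewrite evec_row1.
Qed.

Lemma extmap_evec J (x : 'rV[R]_n) : extmap J (evec x) = evec (x *m J).
Proof.
rewrite /evec extmap_sum.
transitivity (\sum_i x 0 i *: evec (row i J)).
  apply: eq_bigr => i _; rewrite extmapZ extmap_ebas; congr (_ *: _).
  rewrite -[[set i]]finset.setU0 wprodU1; last by move=> t; rewrite inE.
  rewrite /wprod -[enum _]/(enum finset.set0) enum_set0 big_nil.
  by rewrite wedge1r.
under eq_bigr do rewrite /evec scaler_sumr.
rewrite exchange_big; apply: eq_bigr => j _ /=.
rewrite !mxE scaler_suml; apply: eq_bigr => i _.
by rewrite !mxE scalerA.
Qed.

Lemma extmap0set J : extmap J (ebas R finset.set0) = ebas R finset.set0.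
Proof. by rewrite extmap_ebas /wprod -[enum _]/(enum finset.set0) enum_set0 big_nil. Qed.

Lemma extmap_comp J K w : extmap K (extmap J w) = extmap (J *m K) w.
Proof.
apply: (@extmap_unique (J *m K) (extmap K \o extmap J)) => /=.
- by move=> a u v; rewrite !extmap_lin.
- by move=> u v; rewrite !extmap_wedge.
- by rewrite !extmap0set.
- by move=> i; rewrite -evec_row1 !extmap_evec !rowE mulmx1 mulmxA.
Qed.


Lemma ext_scaleE a u S : (a *: u) S = a * u S.
Proof. exact: ffunE. Qed.

Lemma extmap_scale_comp J K L a w :
  J *m K = L -> extmap K (a *: extmap J w) = a *: extmap L w.
Proof. by move=> <-; rewrite extmapZ extmap_comp. Qed.

Definition ehom (k : nat) w := forall T, #|T| != k -> w T = 0.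

Lemma ehom_ebas S : ehom #|S| (ebas R S).
Proof. by move=> T; rewrite ffunE; case: (eqVneq T S) => // TS; rewrite TS eqxx. Qed.

Lemma ehom_set0 : ehom 0 (ebas R finset.set0).
Proof. by rewrite -(@cards0 'I_n); exact: ehom_ebas. Qed.

Lemma ehom_wedge k l u v : ehom k u -> ehom l v -> ehom (k + l) (wedge u v).
Proof.
move=> hu hv T Tkl; rewrite sum_ffunE big1 // => A _.
rewrite sum_ffunE big1 // => B _; rewrite !ffunE.
have [TAB|_] := eqVneq T (A :|: B); last by rewrite [LHS]mulr0.
have [Ak|/hu ->] := eqVneq #|A| k; last by rewrite !mul0r [LHS]mul0r.
have [Bl|/hv ->] := eqVneq #|B| l; last by rewrite mulr0 mul0r [LHS]mul0r.
rewrite /esign; case: ifP => [AB|_]; last by rewrite mulr0 [LHS]mul0r.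
by move: Tkl; rewrite TAB cardsU (eqP (_ : A :&: B == finset.set0)) ?setI_eq0 //
  cards0 subn0 Ak Bl eqxx.
Qed.

(** Each pair in A x B is an inversion for exactly one of the two orders, since disjointness
    excludes ties. *)
Lemma inversionsC A B : [disjoint A & B] ->
  (inversions A B + inversions B A = #|A| * #|B|)%N.
Proof.
move=> dAB; pose sw (p : 'I_n * 'I_n) := (p.2, p.1).
have swK : cancel sw sw by case.
have -> : inversions B A =
    #|[set p : 'I_n * 'I_n | [&& p.1 \in A, p.2 \in B & (p.1 < p.2)%N]]|.
  rewrite -(card_imset _ (can_inj swK)); apply: eq_card => p.
  rewrite -[p]swK (mem_imset _ _ (can_inj swK)) !inE /=.
  by rewrite andbCA.
rewrite -cardsX -cardsUI [X in (_ + X)%N]eq_card0 ?addn0 => [|p]; last first.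
  by rewrite !inE; case: (ltngtP p.1 p.2); rewrite !andbF.
apply: eq_card => p; rewrite !inE -!andb_orr; have [||E] := ltngtP p.1 p.2; rewrite ?andbT //.
rewrite !andbF; symmetry; apply/negbTE/negP => /andP[pA pB].
by move/pred0P/(_ p.1): dAB; rewrite /= pA (val_inj E) pB.
Qed.

Lemma esignC A B : esign R A B = (-1) ^+ (#|A| * #|B|) * esign R B A.
Proof.
rewrite /esign [X in _ * (if X then _ else _)]disjoint_sym.
case: ifPn => AB; last by rewrite mulr0.
by rewrite -(inversionsC AB) exprD -mulrA -expr2 sqrr_sign mulr1.
Qed.

Lemma wedge_anticomm k l u v : ehom k u -> ehom l v ->
  wedge u v = (-1) ^+ (k * l) *: wedge v u.
Proof.
move=> hu hv; rewrite /wedge exchange_big scaler_sumr; apply: eq_bigr => B _ /=.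
rewrite scaler_sumr; apply: eq_bigr => A _.
have [Ak|/hu ->] := eqVneq #|A| k; last by rewrite mulr0 !mul0r !scale0r scaler0.
have [Bl|/hv ->] := eqVneq #|B| l; last by rewrite mulr0 !mul0r !scale0r scaler0.
by rewrite scalerA finset.setUC esignC Ak Bl mulrCA [u A * _]mulrC !mulrA.
Qed.

Lemma wedge1E (j : 'I_n) v T :
  wedge (ebas R [set j]) v T = if j \in T then esign R [set j] (T :\ j) * v (T :\ j) else 0.
Proof.
rewrite wedge_expr sum_ffunE; case: ifPn => jT.
  rewrite (bigD1 (T :\ j)) //= big1 ?addr0 => [|S ST].
    by rewrite wedge_ebas finset.setD1K // !ffunE eqxx [_ *: 1]mulr1 [LHS]mulrC.
  rewrite wedge_ebas !ffunE; case: eqVneq => [TjS|]; last by rewrite scaler0 [LHS]mulr0.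
  rewrite /esign disjoints1; case: ifP => [jS|_]; last by rewrite scale0r [LHS]mulr0.
  by move: ST; rewrite TjS finset.setU1K ?jS // eqxx.
rewrite big1 // => S _; rewrite wedge_ebas !ffunE; case: eqVneq => [TjS|].
  by move: jT; rewrite TjS !inE eqxx.
by rewrite scaler0 [LHS]mulr0.
Qed.

Lemma esign_sqr A B : [disjoint A & B] -> esign R A B * esign R A B = 1.
Proof. by move=> AB; rewrite /esign AB -expr2 sqrr_sign. Qed.

Lemma contract_lin (i : 'I_n) a u v :
  contract i (a *: u + v) = a *: contract i u + contract i v.
Proof. by apply/ffunP => T; rewrite !ffunE mulrDr; congr (_ + _); exact: mulrCA. Qed.

Lemma contract0 i : contract i (0 : ext) = 0.
Proof. by apply/ffunP => T; rewrite !ffunE mulr0. Qed.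

Lemma contractD i u v : contract i (u + v) = contract i u + contract i v.
Proof. by have := contract_lin i 1 u v; rewrite !scale1r. Qed.

Lemma contractZ i a u : contract i (a *: u) = a *: contract i u.
Proof. by have := contract_lin i a u 0; rewrite contract0 !addr0. Qed.

Lemma contract_ehom i k w : ehom k.+1 w -> ehom k (contract i w).
Proof.
move=> hw T Tk; rewrite ffunE /esign disjoints1; case: ifPn => [iT|_]; last exact: mul0r.
by rewrite hw ?mulr0 // cardsU1 iT add1n eqSS.
Qed.

Lemma contract_ehom0 i w : ehom 0 w -> contract i w = 0.
Proof.
move=> hw; apply/ffunP => T; rewrite !ffunE hw ?mulr0 //.
by rewrite cards_eq0; apply/set0Pn; exists i; rewrite !inE eqxx.
Qed.

(** The coordinate at T is picked up once for every i in T, the two signs cancelling, and only sets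
    T with k elements matter. *)
Lemma euler_contract k w : ehom k w ->
  \sum_i wedge (ebas R [set i]) (contract i w) = k%:R *: w.
Proof.
move=> hw; apply/ffunP => T; rewrite sum_ffunE ffunE.
have -> : k%:R *: w T = #|T|%:R * w T.
  by have [->//|/hw ->] := eqVneq #|T| k; rewrite mulr0 scaler0.
rewrite -sum1_card natr_sum mulr_suml [RHS]big_mkcond; apply: eq_bigr => i _.
rewrite wedge1E; case: ifP => // iT.
by rewrite ffunE finset.setD1K // mulrA esign_sqr ?mul1r // disjoints1 !inE eqxx.
Qed.

(** The grade involution; it carries the sign of the antiderivation rule when u is not
    homogeneous. *)
Definition ginv w : ext := [ffun T : {set 'I_n} => (-1) ^+ #|T| * w T].

Lemma ginv_ehom k w : ehom k w -> ginv w = (-1) ^+ k *: w.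
Proof.
move=> hw; apply/ffunP => T; rewrite !ffunE.
by have [->//|/hw ->] := eqVneq #|T| k; rewrite mulr0 scaler0.
Qed.

(** The Clifford-type relation between exterior and interior multiplication. It yields the
    antiderivation rule by adjoining one basis vector at a time. *)
Lemma contract_wedge1 (i j : 'I_n) v :
  contract i (wedge (ebas R [set j]) v) =
  (i == j)%:R *: v - wedge (ebas R [set j]) (contract i v).
Proof.
apply/ffunP => T; rewrite [LHS]ffunE wedge1E ffunE [X in _ + X]ffunE wedge1E.
rewrite [X in X + _]ffunE.
have [<-|ij] := eqVneq i j.
  rewrite setU11 [_ *: v T]mul1r; case: ifPn => iT.
    rewrite ffunE finset.setD1K // [in RHS]mulrA esign_sqr ?mul1r ?subrr; last first.
      by rewrite disjoints1 !inE eqxx.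
    by rewrite [esign R _ T]/esign disjoints1 iT mul0r.
  by rewrite finset.setU1K // mulrA esign_sqr ?disjoints1 // mul1r subr0.
rewrite [_ *: v T]mul0r sub0r !inE eq_sym (negPf ij) /=.
case: ifPn => jT; last by rewrite mulr0 oppr0.
rewrite ffunE; have [iT|iT] := boolP (i \in T).
  by rewrite /esign !disjoints1 iT !inE ij iT /= mul0r mul0r mulr0 oppr0.
have -> : (i |: T) :\ j = i |: (T :\ j).
  by apply/setP => t; rewrite !inE; case: (eqVneq t j) => // ->; rewrite (negPf (_ : j != i)) // eq_sym.
rewrite !mulrA -mulNr; congr (_ * _).
have H A a b : a \notin A -> b \notin A -> a != b ->
    esign R [set a] (b |: A) = esign R [set a] [set b] * esign R [set a] A.
  move=> aA bA ab; rewrite /esign !disjoints1 !inE negb_or ab aA /=.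
  by rewrite inversionsUr ?disjoints1 // exprD.
have jT' : j \notin T :\ j by rewrite !inE eqxx.
have iT' : i \notin T :\ j by rewrite !inE (negPf iT) andbF.
rewrite -{1}(finset.setD1K jT) !H // 1?eq_sym // mulrACA.
rewrite (esignC [set j] [set i]) !cards1 mul1n expr1 mulN1r mulrN esign_sqr ?disjoints1 ?inE //.
by rewrite mulN1r mulrC.
Qed.

Lemma wedgeNl u v : wedge (- u) v = - wedge u v.
Proof. by rewrite -scaleN1r wedgeZl scaleN1r. Qed.

Lemma contract_wedge i u v :
  contract i (wedge u v) = wedge (contract i u) v + wedge (ginv u) (contract i v).
Proof.
have ginv_lin a (x y : ext) : ginv (a *: x + y) = a *: ginv x + ginv y.
  by apply/ffunP => T; rewrite !ffunE mulrDr mulrCA.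
have HB S w : contract i (wedge (ebas R S) w) =
    wedge (contract i (ebas R S)) w + wedge (ginv (ebas R S)) (contract i w).
  elim/set_ltn_ind: S w => [|m S mS IH] w.
    by rewrite (ginv_ehom ehom_set0) expr0 scale1r !wedge1l (contract_ehom0 i ehom_set0) wedge0l add0r.
  have -> : ebas R (m |: S) = wedge (ebas R [set m]) (ebas R S).
    by rewrite wedge_ebas esign_lt // scale1r.
  rewrite -(wedgeA (ebas R [set m]) (ebas R S) w).
  rewrite (contract_wedge1 i m (wedge (ebas R S) w)) (contract_wedge1 i m (ebas R S)) IH.
  have g1 x : ginv (wedge (ebas R [set m]) x) = - wedge (ebas R [set m]) (ginv x).
    apply/ffunP => T; rewrite [LHS]ffunE !wedge1E [RHS]ffunE wedge1E.
    case: ifP => mT; last by rewrite mulr0 oppr0.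
    by rewrite ffunE (cardsD1 m T) mT exprS mulN1r mulNr mulrCA.
  rewrite g1 wedgeDr opprD wedgeDl wedgeZl addrA !wedgeNl.
  by rewrite -!wedgeA.
rewrite (ext_sum u) wedge_suml.
have Csum (F : {set 'I_n} -> ext) : contract i (\sum_S F S) = \sum_S contract i (F S).
  by apply: (big_morph (contract i)) => [x y|]; [exact: contractD|exact: contract0].
have ginv0 : ginv 0 = 0 by have := ginv_lin (-1) 0 0; rewrite scaler0 addr0 scaleN1r addNr.
have ginvsum (F : {set 'I_n} -> ext) : ginv (\sum_S F S) = \sum_S ginv (F S).
  apply: (big_morph ginv) => [x y|]; last exact: ginv0.
  by have := ginv_lin 1 x y; rewrite !scale1r.
rewrite !Csum ginvsum !wedge_suml -big_split; apply: eq_bigr => S _ /=.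
have := ginv_lin (u S) (ebas R S) 0; rewrite ginv0 !addr0 => ->.
by rewrite (wedgeZl (u S) (ebas R S) v) (contractZ i (u S) (wedge _ v)) HB contractZ !wedgeZl scalerDr.
Qed.

Lemma ehom0E u : ehom 0 u -> u = u finset.set0 *: ebas R finset.set0.
Proof.
move=> hu; apply/ffunP => T; rewrite !ffunE; have [T0|T0] := eqVneq T finset.set0.
  by rewrite T0 [RHS]mulr1.
by rewrite (hu T) ?cards_eq0 // scaler0.
Qed.

Lemma wedge_ehom0 u v : ehom 0 u -> wedge u v = u finset.set0 *: v.
Proof. by move=> /ehom0E {1}->; rewrite wedgeZl wedge1l. Qed.

Lemma ehom0 k : ehom k 0.
Proof. by move=> T _; rewrite ffunE. Qed.

Lemma ehomD k u v : ehom k u -> ehom k v -> ehom k (u + v).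
Proof. by move=> hu hv T Tk; rewrite ffunE hu // hv // addr0. Qed.

Lemma ehomZ k a u : ehom k u -> ehom k (a *: u).
Proof. by move=> hu T Tk; rewrite ffunE hu // scaler0. Qed.

Lemma ehom_evec (x : 'rV[R]_n) : ehom 1 (evec x).
Proof.
rewrite /evec; elim/big_ind: _ => [|u v|i _]; [exact: ehom0|exact: ehomD|].
by apply: ehomZ; rewrite -(cards1 i); exact: ehom_ebas.
Qed.

Lemma ehom_wprod J S : ehom #|S| (wprod J S).
Proof.
elim/set_ltn_ind: S => [|m S mS IH].
  rewrite /wprod -[enum _]/(enum finset.set0) enum_set0 big_nil.
  exact: ehom_ebas.
rewrite wprodU1 // cardsU1 (_ : m \notin S); first exact: ehom_wedge (@ehom_evec _) IH.
by apply/negP => /mS; rewrite ltnn.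
Qed.

Lemma ehom_extmap J k u : ehom k u -> ehom k (extmap J u).
Proof.
move=> hu; rewrite /extmap; elim/big_ind: _ => [|x y|S _]; [exact: ehom0|exact: ehomD|].
have [<-|/hu ->] := eqVneq #|S| k; last by rewrite scale0r; exact: ehom0.
exact/ehomZ/ehom_wprod.
Qed.

Definition egr (k : nat) w : ext := [ffun T : {set 'I_n} => (#|T| == k)%:R * w T].

Lemma egr_ehom k w : ehom k (egr k w).
Proof. by move=> T /negPf Tk; rewrite ffunE Tk mul0r. Qed.

Lemma egr_id k w : ehom k w -> egr k w = w.
Proof.
move=> hw; apply/ffunP => T; rewrite ffunE; case: eqVneq => [|/hw ->]; first by rewrite mul1r.
by rewrite mulr0.
Qed.

Lemma egr_other k l w : ehom l w -> l != k -> egr k w = 0.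
Proof.
move=> hw lk; apply/ffunP => T; rewrite !ffunE.
by have [->|/hw ->] := eqVneq #|T| l; rewrite ?mulr0 // (negPf lk) mul0r.
Qed.

Lemma egr_lin k a u v : egr k (a *: u + v) = a *: egr k u + egr k v.
Proof. by apply/ffunP => T; rewrite !ffunE mulrDr; congr (_ + _); exact: mulrCA. Qed.

Lemma egr_sum w : w = \sum_(k < n.+1) egr k w.
Proof.
apply/ffunP => T; rewrite sum_ffunE.
have Tn : (#|T| < n.+1)%N by rewrite ltnS -[n in (_ <= n)%N]card_ord max_card.
rewrite (bigD1 (Ordinal Tn)) //= big1 ?addr0 => [|k kT].
  by rewrite ffunE eqxx mul1r.
rewrite ffunE (negPf (_ : #|T| != k)) ?mul0r //.
by apply: contraNneq kT => Tk; apply/eqP/val_inj.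
Qed.

(** Changes of coordinates preserve degrees; hence the homogeneous components of a smooth field are
    smooth. *)
Lemma egr_extmap J k w : egr k (extmap J w) = extmap J (egr k w).
Proof.
rewrite {1}(egr_sum w) extmap_sum.
have egr0 : egr k 0 = 0 by apply/ffunP => T; rewrite !ffunE mulr0.
have egrD u v : egr k (u + v) = egr k u + egr k v.
  by have := egr_lin k 1 u v; rewrite !scale1r.
rewrite (big_morph (egr k) egrD egr0).
have hE l : ehom l (extmap J (egr l w)) by exact/ehom_extmap/egr_ehom.
have [kn|nk] := ltnP k n.+1.
  rewrite (bigD1 (Ordinal kn)) //= big1 ?addr0; first exact: egr_id.
  by move=> l lk; apply: egr_other (hE l) _; apply: contraNneq lk => lk; apply/eqP/val_inj.
rewrite big1; last first.
  move=> l _; apply: egr_other (hE l) _; apply: contraTneq nk => <-; rewrite -ltnNge.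
  exact: ltn_ord.
rewrite (_ : egr k w = 0) ?extmap0 //; apply/ffunP => T; rewrite !ffunE.
rewrite (negPf (_ : #|T| != k)) ?mul0r //; apply: contraTneq nk => <-.
by rewrite -ltnNge ltnS -[n in (_ <= n)%N]card_ord max_card.
Qed.

(* Interior product with dx^i, read in the basis given by the matrix K with inverse J. *)
Definition fcontract J K (p : R) (i : 'I_n) w : ext := p *: extmap K (contract i (extmap J w)).

Lemma fcontract_lin J K p i a u v :
  fcontract J K p i (a *: u + v) = a *: fcontract J K p i u + fcontract J K p i v.
Proof.
by rewrite /fcontract extmap_lin contract_lin extmap_lin scalerDr !scalerA [p * a]mulrC.
Qed.

Lemma fcontract_ehom J K p i k w : ehom k.+1 w -> ehom k (fcontract J K p i w).
Proof. by move=> hw; exact/ehomZ/ehom_extmap/contract_ehom/ehom_extmap. Qed.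

Lemma fcontract_ehom0 J K p i w : ehom 0 w -> fcontract J K p i w = 0.
Proof.
by move=> hw; rewrite /fcontract contract_ehom0 ?extmap0 ?scaler0 //; exact: ehom_extmap.
Qed.

Lemma fcontract_wedge J K p i k u v : J *m K = 1%:M -> ehom k u ->
  fcontract J K p i (wedge u v) =
  wedge (fcontract J K p i u) v + (-1) ^+ k *: wedge u (fcontract J K p i v).
Proof.
move=> JK hu.
have KJ x : extmap K (extmap J x) = x by rewrite extmap_comp JK extmap1.
rewrite /fcontract extmap_wedge contract_wedge (ginv_ehom (ehom_extmap J hu)).
rewrite extmapD !extmap_wedge extmapZ !KJ scalerDr !wedgeZl wedgeZr !scalerA.
by rewrite [p * _]mulrC.
Qed.

(** The vector and the contraction each carry the bump value p, whence p * p: for this reason the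
    function of a frame is built as the square of a bump. *)
Lemma euler_fcontract J K p k w : J *m K = 1%:M -> ehom k w ->
  \sum_i wedge (p *: extmap K (ebas R [set i])) (fcontract J K p i w) =
  k%:R *: wedge ((p * p) *: ebas R finset.set0) w.
Proof.
move=> JK hw.
have KJ x : extmap K (extmap J x) = x by rewrite extmap_comp JK extmap1.
transitivity ((p * p) *: extmap K (\sum_i wedge (ebas R [set i]) (contract i (extmap J w)))).
  rewrite extmap_sum scaler_sumr; apply: eq_bigr => i _.
  by rewrite /fcontract wedgeZl wedgeZr scalerA extmap_wedge.
rewrite (euler_contract (ehom_extmap J hw)) extmapZ KJ wedgeZl wedge1l !scalerA.
by rewrite mulrC.
Qed.

End ExteriorAlgebraFacts.

Local Open Scope classical_set_scope.

(** * Smooth maps between Euclidean spaces *)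

Section Differentiability.
Variables (R : realType) (n : nat).
Implicit Types (V : set 'rV[R]_n) (f : 'rV[R]_n -> R).

Lemma is_derive_line f (z : 'rV[R]_n) (v : 'rV[R]_n) (s : R) :
  derivable f (z + s *: v) v ->
  is_derive s 1 (fun t : R => f (z + t *: v)) ('D_v f (z + s *: v)).
Proof.
have E : (fun h : R => h^-1 *: (f (z + (h *: 1 + s) *: v) - f (z + s *: v)))
       = (fun h : R => h^-1 *: (f (h *: v + (z + s *: v)) - f (z + s *: v))).
  by apply/funext => h; rewrite scalerDl -scalerA scale1r addrCA.
move=> df; split; first by rewrite /derivable E.
by rewrite /derive E.
Qed.

(** The mean value theorem on the segment turns a bound on the variation of the directional
    derivative into a bound on the increment. *)
Lemma line_increment f (z v : 'rV[R]_n) (c e t : R) :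
  (forall s, `|s| <= `|t| -> derivable f (z + s *: v) v /\
     `|'D_v f (z + s *: v) - c| <= e) ->
  `|f (z + t *: v) - f z - c * t| <= e * `|t|.
Proof.
move=> H.
pose g (s : R) := f (z + s *: v).
have dg (s : R) : `|s| <= `|t| -> is_derive s 1 g ('D_v f (z + s *: v)).
  by move=> /H[df _]; exact: is_derive_line.
have cg (s : R) : `|s| <= `|t| -> {for s, continuous g}.
  by move=> /dg[dgs _]; apply: differentiable_continuous; exact/derivable1_diffP.
have -> : f (z + t *: v) - f z = g t - g 0 by rewrite /g scale0r addr0.
have [t0|t0|->] := ltgtP t 0; last by rewrite subrr mulr0 normr0 mulr0 subr0 normr0.
- have st (s : R) : s \in `[t, 0]%R -> `|s| <= `|t|.
    by rewrite in_itv/= => /andP[ts s0]; rewrite !ler0_norm ?lerN2 // ltW.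
  have [|u ut E] := MVT t0 (fun (s : R) hs => dg s (st s (subset_itv_oo_cc hs))).
    by apply: continuous_in_subspaceT => s /set_mem/st; exact: cg.
  have -> : g t - g 0 - c * t = ('D_v f (z + u *: v) - c) * t.
    by rewrite mulrBl; congr (_ - _); rewrite -opprB E sub0r mulrN opprK.
  by rewrite normrM ler_wpM2r //; have [] := H u (st u (subset_itv_oo_cc ut)).
- have st (s : R) : s \in `[0, t]%R -> `|s| <= `|t|.
    by rewrite in_itv/= => /andP[s0 ts]; rewrite !ger0_norm // ltW.
  have [|u ut E] := MVT t0 (fun (s : R) hs => dg s (st s (subset_itv_oo_cc hs))).
    by apply: continuous_in_subspaceT => s /set_mem/st; exact: cg.
  have -> : g t - g 0 - c * t = ('D_v f (z + u *: v) - c) * t.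
    by rewrite mulrBl; congr (_ - _); rewrite E subr0.
  by rewrite normrM ler_wpM2r //; have [] := H u (st u (subset_itv_oo_cc ut)).
Qed.

Lemma normr_entry (h : 'rV[R]_n) i : `|h 0 i| <= `|h|.
Proof. by rewrite [leRHS]/Num.Def.normr/= mx_normrE; exact: (le_bigmax _ _ (0, i)). Qed.

Lemma ler_norm_rV (h : 'rV[R]_n) (e : R) : 0 <= e -> (forall i, `|h 0 i| <= e) -> `|h| <= e.
Proof.
move=> e0 H; rewrite [leLHS]/Num.Def.normr/= mx_normrE; apply: bigmax_le => //.
by case=> i j _; rewrite /= (ord1 i).
Qed.

Definition dotp (c h : 'rV[R]_n) : R := \sum_i h 0 i * c 0 i.

Lemma dotp_linear c : linear (dotp c).
Proof.
move=> a u v; rewrite /dotp scaler_sumr -big_split; apply: eq_bigr => i _ /=.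
by rewrite !mxE mulrDl [in RHS]/GRing.scale /= mulrA.
Qed.

HB.instance Definition _ (c : 'rV[R]_n) :=
  GRing.isLinear.Build R 'rV[R]_n R *:%R (dotp c) (dotp_linear c).

Lemma Ck_continuous k V f x : Ck k V f -> V x -> {for x, continuous f}.
Proof. by case: k => [|k] [cf _]; exact: cf. Qed.

(** The increment from x to x + h is cut into n moves along the coordinate axes. Each is controlled
    by [line_increment], continuity of the partial derivatives making the errors small. *)
Lemma C1_differentiable k V f (x : 'rV[R]_n) : open V -> Ck k.+1 V f -> V x ->
  differentiable f x.
Proof.
move=> oV [_ Hf] Vx.
have df i y : V y -> derivable f y (unitv R i) by move=> Vy; apply: (Hf i).1.
have cdf i : {for x, continuous ('D_(unitv R i) f)} by apply: Ck_continuous Vx; exact: (Hf i).2.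
pose c : 'rV[R]_n := \row_i 'D_(unitv R i) f x.
pose L : {linear 'rV[R]_n -> R} := dotp c.
have cc i : continuous (fun h : 'rV[R]_n => h 0 i * c 0 i).
  move=> y; apply: (@continuousM _ _ (fun h : 'rV[R]_n => h 0 i) (cst (c 0 i))).
    exact: coord_continuous.
  exact: cst_continuous.
have cL : continuous L.
  by apply: continuous_big => [|i _]; [exact: add_continuous|exact: cc].
suff H : f \o shift x = cst (f x) + L +o_ (0 : 'rV[R]_n) id.
  by apply/diff_locallyP; rewrite (diff_unique cL H).
apply/eqaddoP => _ /posnumP[e].
(* Each of the n moves may contribute e / (n + 1); the denominator [n.+1] also covers n = 0. *)
have [r /= r0 rH] : exists2 r : R, 0 < r & forall y : 'rV[R]_n, `|y - x| <= r ->
    V y /\ forall i, `|'D_(unitv R i) f y - c 0 i| <= e%:num / n.+1%:R.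
  have e0 : 0 < e%:num / n.+1%:R by rewrite divr_gt0.
  have : \forall y \near x, V y /\ forall i, `|'D_(unitv R i) f y - c 0 i| <= e%:num / n.+1%:R.
    near=> y; split; first by near: y; exact: (open_nbhs_nbhs (conj oV Vx)).
    near: y; apply: filter_forall => i.
    have /cvgrPdist_le /(_ _ e0) := cdf i.
    by apply: filterS => y; rewrite distrC /c mxE.
  move=> /nbhs_ballP[r /= r0 rH]; exists (r / 2); first by rewrite divr_gt0.
  move=> y yr; apply: rH; rewrite -ball_normE /= distrC (le_lt_trans yr) //.
  by rewrite ltr_pdivrMr // ltr_pMr // ltr1n.
near=> h.
have hr : `|h| <= r.
  by near: h; exact: (@nbhs0_le R 'rV[R]_n r r0).
(* [p k] keeps the first k entries of h, so that consecutive points differ in one coordinate. *)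
pose p (k : nat) : 'rV[R]_n := \row_i (if (i < k)%N then h 0 i else 0).
have pS (i : 'I_n) : p i.+1 = p i + h 0 i *: unitv R i.
  apply/rowP => j; rewrite !mxE eqxx /= ltnS leq_eqVlt.
  have [/val_inj ->|ji] := eqVneq (j : nat) (i : nat).
    by rewrite ltnn add0r eqxx mulr1.
  have -> : (j == i) = false by apply: contraNF ji => /eqP ->.
  by rewrite mulr0 addr0.
have step (i : 'I_n) : `|f (x + p i.+1) - f (x + p i) - c 0 i * h 0 i| <= e%:num / n.+1%:R * `|h|.
  rewrite pS addrA; apply: le_trans (_ : _ <= e%:num / n.+1%:R * `|h 0 i|) _; last first.
    by rewrite ler_wpM2l ?divr_ge0 // normr_entry.
  apply: line_increment => s sh.
  have [|Vy Dy] := rH (x + p i + s *: unitv R i).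
    rewrite addrAC [x + _]addrC addrK; apply: le_trans hr; apply: ler_norm_rV => // j.
    rewrite !mxE eqxx /=; have [ji|ij] := ltnP j i.
      rewrite (_ : (j == i) = false) ?mulr0 ?addr0 ?normr_entry //.
      by apply: contraTF ji => /eqP ->; rewrite ltnn.
    rewrite add0r normrM; apply: le_trans (normr_entry h i); apply: le_trans sh.
    by case: (j == i); rewrite ?normr1 ?mulr1 // normr0 mulr0.
  by split; [exact: df|exact: Dy].
rewrite [X in `|X| <= _](_ : _ =
    \sum_(i < n) (f (x + p i.+1) - f (x + p i) - c 0 i * h 0 i)); last first.
  rewrite sumrB (_ : \sum_(i < n) _ = f (x + p n) - f (x + p 0)); last first.
    rewrite -(big_mkord xpredT (fun i => f (x + p i.+1) - f (x + p i))) telescope_sumr //.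
  have -> : p 0 = 0 by apply/rowP => i; rewrite !mxE.
  have -> : p n = h by apply/rowP => i; rewrite !mxE ltn_ord.
  rewrite addr0 [x + h]addrC -addrA -opprD.
  congr (_ - (_ + _)); apply: eq_bigr => i _; exact: mulrC.
apply: le_trans (ler_norm_sum _ _ _) _.
apply: le_trans (ler_sum _ (fun i _ => step i)) _.
rewrite sumr_const card_ord -mulrnAl; apply: ler_wpM2r => //.
rewrite -mulr_natr -mulrA ler_piMr // mulrC ler_pdivrMr // mul1r.
by rewrite ler_nat.
Unshelve. all: by end_near. Qed.
End Differentiability.

(** * Locality, composition and Jacobians of smooth maps *)

Section SmoothMaps.
Variables (R : realType).

Section Locality.
Variable n : nat.
Implicit Types (V W : set 'rV[R]_n) (f : 'rV[R]_n -> R).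

(** W need not be open: [Ck] imposes conditions at single points, on derivatives of the globally
    defined f. *)
Lemma Ck_local k V f :
  (forall x, V x -> exists2 W : set 'rV[R]_n, W x & Ck k W f) -> Ck k V f.
Proof.
elim: k f => [|k IH] f H.
  by split=> // x /H[W Wx [cf _]]; exact: cf.
split=> [x /H[W Wx [cf _]]|i]; first exact: cf.
split=> [x /H[W Wx [_ /(_ i)[df _]]]|]; first exact: df.
by apply: IH => x /H[W Wx [_ /(_ i)[_ Df]]]; exists W.
Qed.

Lemma smooth_on_local V f :
  (forall x, V x -> exists2 W : set 'rV[R]_n, W x & smooth_on W f) -> smooth_on V f.
Proof. by move=> H k; apply: Ck_local => x /H[W Wx sf]; exists W. Qed.

Lemma smooth_onS V W f : V `<=` W -> smooth_on W f -> smooth_on V f.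
Proof. by move=> VW sf; apply: smooth_on_local => x /VW Wx; exists W. Qed.

Lemma eq_smooth_on V f g : open V -> (forall x, V x -> f x = g x) ->
  smooth_on V f -> smooth_on V g.
Proof. by move=> oV fg sf k; apply: (eq_Ck oV fg). Qed.

Lemma smooth_on_derive V f i : smooth_on V f -> smooth_on V ('D_(unitv R i) f).
Proof. by move=> sf k; have [_ /(_ i)[]] := sf k.+1. Qed.

Lemma smooth_on_differentiable V f x : open V -> smooth_on V f -> V x ->
  differentiable f x.
Proof. by move=> oV sf Vx; exact: (C1_differentiable oV (sf 1)). Qed.

Lemma smooth_on_coord V i : smooth_on V (fun z : 'rV[R]_n => z 0 i).
Proof.
move=> k; elim: k => [|k _]; first by split=> // x _; exact: coord_continuous.
split=> [x _|j]; first exact: coord_continuous.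
split=> [x _|].
  by have /derivable_mxP := @derivable_id R 'rV[R]_n x (unitv R j); apply.
rewrite (_ : 'D_(unitv R j) _ = fun=> unitv R j 0 i); first exact: Ck_cst.
apply/funext => x; have := derive_mx (@derivable_id R 'rV[R]_n x (unitv R j)).
by move=> /matrixP/(_ 0 i); rewrite mxE derive_id => ->.
Qed.

Lemma Ck_inv k V f : open V -> (forall x, V x -> f x != 0) -> Ck k V f ->
  Ck k V (fun x => (f x)^-1).
Proof.
move=> oV f0; elim: k => [|k IH] Cf.
  by case: Cf => cf _; split=> // x Vx; apply: continuousV; [exact: f0|exact: cf].
have [cf Df] := Cf; split=> [x Vx|i].
  by apply: continuousV; [exact: f0|exact: cf].
have [df Dkf] := Df i; split=> [x Vx|].
  by apply: derivableV; [exact: f0|exact: df].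
apply: (@eq_Ck _ _ _ _ (fun x => -1 * ((f x)^-1 * (f x)^-1 * 'D_(unitv R i) f x))) => //.
  move=> x Vx; rewrite deriveV ?f0 //; last exact: df.
  by rewrite [RHS]/GRing.scale /= mulN1r -exprVn expr2 mulNr.
have := IH (CkS Cf) => IHf.
apply: (@Ck_mul _ _ _ _ (fun=> -1)) => //; first exact: Ck_cst.
by apply: Ck_mul => //; apply: Ck_mul.
Qed.

Lemma smooth_on_inv V f : open V -> (forall x, V x -> f x != 0) -> smooth_on V f ->
  smooth_on V (fun x => (f x)^-1).
Proof. by move=> oV f0 sf k; exact: Ck_inv. Qed.

End Locality.

Section Composition.
Variables m n : nat.
Implicit Types (V : set 'rV[R]_m) (W : set 'rV[R]_n).
Implicit Types (f : 'rV[R]_n -> R) (g : 'rV[R]_m -> 'rV[R]_n).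

Lemma smooth_map_differentiable V g x : open V ->
  (forall j, smooth_on V (fun z => g z 0 j)) -> V x -> differentiable g x.
Proof.
move=> oV sg Vx.
rewrite (_ : g = \sum_(j < n) (fun z => g z 0 j *: unitv R j)).
  apply: differentiable_sum => j; apply: differentiableZl.
  exact: smooth_on_differentiable oV (sg j) Vx.
apply/funext => z; rewrite fct_sumE {1}(row_sum_delta (g z)).
by apply: eq_bigr.
Qed.

Lemma derive_comp_map g f x i : differentiable g x -> differentiable f (g x) ->
  'D_(unitv R i) (f \o g) x =
  \sum_j 'D_(unitv R j) f (g x) * 'D_(unitv R i) (fun z => g z 0 j) x.
Proof.
move=> dg df.
rewrite deriveE; last exact: differentiable_comp.
rewrite diff_comp //= (_ : 'd g x (unitv R i) = 'D_(unitv R i) g x); last by rewrite deriveE.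
rewrite derive_mx; last exact: diff_derivable.
rewrite (row_sum_delta (\matrix_(_, _) _)) linear_sum; apply: eq_bigr => j _.
by rewrite linearZ /= -deriveE // mxE mulrC.
Qed.

(** The induction varies f with g fixed: by the chain rule the partial derivatives of the composite
    combine those of f, one degree lower and composed with g, with derivatives of g, which stay
    smooth. *)
Lemma Ck_comp k V W f g : open V -> open W -> (forall x, V x -> W (g x)) ->
  (forall j, smooth_on V (fun x => g x 0 j)) -> Ck k W f -> Ck k V (f \o g).
Proof.
move=> oV oW gVW sg.
have dg x : V x -> differentiable g x by exact: smooth_map_differentiable.
have cg x : V x -> {for x, continuous g} by move=> /dg; exact: differentiable_continuous.
elim: k f => [|k IH] f Cf.
  have [cf _] := Cf; split=> // x Vx.
  by apply: continuous_comp; [exact: cg|exact/cf/gVW].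
have [cf Df] := Cf; have df y : W y -> differentiable f y.
  by apply: C1_differentiable oW Cf.
split=> [x Vx|i].
  by apply: continuous_comp; [exact: cg|exact/cf/gVW].
split=> [x Vx|].
  by apply: diff_derivable; apply: differentiable_comp; [exact: dg|exact/df/gVW].
apply: (@eq_Ck _ _ _ _ (fun x => \sum_j 'D_(unitv R j) f (g x) *
    'D_(unitv R i) (fun z => g z 0 j) x)) => //.
  by move=> x Vx; rewrite derive_comp_map //; [exact: dg|exact/df/gVW].
suff H (r : seq 'I_n) : Ck k V (fun x => \sum_(j <- r) 'D_(unitv R j) f (g x) *
    'D_(unitv R i) (fun z => g z 0 j) x) by exact: H.
elim: r => [|j r IHr].
  by under eq_fun do rewrite big_nil; exact: Ck_cst.
under eq_fun do rewrite big_cons.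
apply: Ck_add => //; apply: Ck_mul => //; last exact: smooth_on_derive.
by apply: (IH ('D_(unitv R j) f)); case: (Df j).
Qed.

Lemma smooth_on_comp V W f g : open V -> open W -> (forall x, V x -> W (g x)) ->
  (forall j, smooth_on V (fun x => g x 0 j)) -> smooth_on W f ->
  smooth_on V (fun x => f (g x)).
Proof. by move=> oV oW VW sg sf k; exact: (Ck_comp (f := f) oV oW). Qed.

Lemma jacobianE g x i j : differentiable g x ->
  'J g x i j = 'D_(unitv R i) (fun z => g z 0 j) x.
Proof.
move=> dg; have := deriveEjacobian (unitv R i) dg.
rewrite -rowE derive_mx; last exact: diff_derivable.
by move=> /rowP/(_ j); rewrite !mxE => ->.
Qed.

Lemma near_eq_jacobian g1 g2 x : differentiable g1 x -> differentiable g2 x ->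
  (\near x, g1 x = g2 x) -> 'J g1 x = 'J g2 x.
Proof.
move=> d1 d2 E; apply/matrixP => i j.
apply: etrans (jacobianE i j d1) _; apply: etrans (esym (jacobianE i j d2)).
by apply: near_eq_derive; near=> z; congr (fun_of_matrix _ 0 j); near: z.
Unshelve. all: by end_near.
Qed.

Lemma smooth_on_jacobian V g i j : open V ->
  (forall j, smooth_on V (fun z => g z 0 j)) -> smooth_on V (fun x => 'J g x i j).
Proof.
move=> oV sg; apply: (eq_smooth_on oV) (smooth_on_derive i (sg j)) => x Vx.
by rewrite jacobianE //; exact: smooth_map_differentiable Vx.
Qed.
End Composition.

Lemma jacobian_comp m n p (g : 'rV[R]_m -> 'rV[R]_n) (f : 'rV[R]_n -> 'rV[R]_p) x :
  differentiable g x -> differentiable f (g x) ->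
  'J (f \o g) x = 'J g x *m 'J f (g x).
Proof.
move=> dg df; apply/row_matrixP => i; rewrite !rowE mulmxA.
rewrite -(deriveEjacobian (delta_mx 0 i) (differentiable_comp dg df)).
rewrite -(deriveEjacobian (delta_mx 0 i) dg) -(deriveEjacobian _ df).
rewrite (deriveE _ (differentiable_comp dg df)) (deriveE _ dg) (deriveE _ df).
by rewrite (diff_comp dg df).
Qed.

Lemma jacobian_id n (x : 'rV[R]_n) : 'J (fun y => y) x = 1%:M.
Proof.
apply/row_matrixP => i; rewrite !rowE -deriveEjacobian // mulmx1.
exact: derive_id.
Qed.

End SmoothMaps.

(** * Bump functions *)

Section Flat.
Variable R : realType.

(* The factor t^-m makes the family closed under d/dt. *)
Definition flat (m : nat) (t : R) : R :=
  if 0 < t then t^-1 ^+ m * expR (- t^-1) else 0.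

Lemma flat_ge0 m t : 0 <= flat m t.
Proof.
rewrite /flat; case: ifP => // t0.
by rewrite mulr_ge0 ?expR_ge0 // exprn_ge0 // invr_ge0 ltW.
Qed.

Lemma flat_gt0 m t : 0 < t -> 0 < flat m t.
Proof. by move=> t0; rewrite /flat t0 mulr_gt0 ?expR_gt0 // exprn_gt0 // invr_gt0. Qed.

(** One term of the exponential series dominates the pole: (1/t)^(m+1) / (m+1)! is at most exp(1/t).
    The spare power of t is what yields the limit 0 at the origin. *)
Lemma flat_le m t : flat m t <= (m.+1)`!%:R * `|t|.
Proof.
rewrite /flat; case: ifP => [t0|_]; last by rewrite mulr_ge0.
have s0 : 0 < t^-1 by rewrite invr_gt0.
have c0 : (m.+1)`!%:R != 0 :> R by rewrite pnatr_eq0 -lt0n fact_gt0.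
have H : t^-1 ^+ m.+1 / (m.+1)`!%:R <= expR t^-1.
  by have := expR_ge1Dxn m (ltW (_ : 0 < t^-1)); rewrite invr_gt0 => /(_ t0); apply: le_trans; rewrite lerDr.
rewrite gtr0_norm // expRN ler_pdivrMr ?expR_gt0 //.
apply: le_trans (_ : _ <= (m.+1)`!%:R * t * (t^-1 ^+ m.+1 / (m.+1)`!%:R)) _.
  rewrite exprS; set u := t^-1 ^+ m; rewrite le_eqVlt; apply/orP; left; apply/eqP.
  by field; rewrite c0 gt_eqF.
by rewrite ler_pM2l // mulr_gt0 // ltr0n fact_gt0.
Qed.

Lemma is_derive_flat m (t : R) :
  is_derive t 1 (flat m) (- (m%:R * flat m.+1 t) + flat m.+2 t).
Proof.
have [t0|t0|->] := ltgtP t 0.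
- rewrite /flat !ltNge (ltW t0) /= mulr0 oppr0 addr0.
  apply: (@near_eq_is_derive _ _ _ (cst 0)).
  near=> u; rewrite /= ifF //; apply/negbTE; rewrite -leNgt ltW //.
  by near: u; exact: lt_nbhsl.
- have tn0 : t != 0 by rewrite gt_eqF.
  pose g (u : R) : R := u^-1.
  have dg : is_derive t 1 g (- t ^- 2).
    have := is_deriveV tn0 (is_derive_id t (1 : R)).
    by rewrite [_ *: _]mulr1.
  have dX := is_deriveX m dg.
  have dE : is_derive t 1 (expR \o (- g)) (expR (- t^-1) * t ^- 2).
    by have := is_derive1_comp (is_derive_expR ((- g) t)) (is_deriveN dg); rewrite opprK.
  apply: (@near_eq_is_derive _ _ _ ((g ^+ m) * (expR \o (- g)))).
    near=> u; have u0 : 0 < u by near: u; exact: lt_nbhsr.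
    by rewrite /flat u0 !fctE.
  have [d1 d2] := is_deriveM dX dE; split; [exact: d1|rewrite [LHS]d2].
  have gX k : (g ^+ k) t = t^-1 ^+ k.
    by elim: k => [|k IHk]; rewrite ?expr0 // !exprS -IHk.
  have -> : (expR \o - g) t = expR (- t^-1) by [].
  rewrite gX /flat t0 -exprVn; case: m {dX d1 d2} => [|m].
    by rewrite !mul0r scale0r scaler0 addr0 oppr0 add0r expr0 [LHS]mul1r mulrC.
  rewrite /GRing.scale /= /g !exprS; set u := t^-1; set v := expR _.
  by set w := u ^+ m; ring.
- have F0 k : flat k 0 = 0 by rewrite /flat ltxx.
  rewrite !F0 mulr0 oppr0 addr0.
  (* At 0 the difference quotient of [flat m] is [flat m.+1], which tends to 0 by [flat_le]. *)
  suff L : h^-1 *: (flat m (h *: 1 + 0) - flat m 0) @[h --> 0^'] --> (0 : R).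
    by split; [apply/cvg_ex; exists 0|apply/cvg_lim].
  apply/cvgrPdist_le => /= e e0; near=> h.
  rewrite F0 subr0 addr0 sub0r normrN [h *: 1]mulr1.
  have -> : h^-1 *: flat m h = flat m.+1 h.
    by rewrite /flat /GRing.scale /=; case: ifP => _; rewrite ?mulr0 // mulrA -exprS.
  rewrite ger0_norm ?flat_ge0 //; apply: le_trans (flat_le _ _) _.
  rewrite -ler_pdivlMl ?ltr0n ?fact_gt0 //; near: h.
  by apply: dnbhs0_le; rewrite mulr_gt0 // invr_gt0 ltr0n fact_gt0.
Unshelve. all: by end_near. Qed.

(** The derivative of [flat m] combines [flat m.+1] and [flat m.+2], so the induction on k treats
    all m at once. The real variable is a row of length one because [Ck] speaks of row vectors. *)
Lemma Ck_flat k m : Ck k [set: 'rV[R]_1] (fun z => flat m (z 0 0)).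
Proof.
have dfl l (z : 'rV[R]_1) i : is_derive z (unitv R i) (fun z => flat l (z 0 0))
    (- (l%:R * flat l.+1 (z 0 0)) + flat l.+2 (z 0 0)).
  have [d1 d2] := is_derive_flat l (z 0 0).
  have E : (fun h : R => h^-1 *: (flat l ((h *: unitv R i + z) 0 0) - flat l (z 0 0)))
         = (fun h : R => h^-1 *: (flat l (h *: 1 + z 0 0) - flat l (z 0 0))).
    by apply/funext => h; rewrite !mxE (ord1 i) eqxx.
  by split; [rewrite /derivable E|rewrite /derive E].
have cfl l (z : 'rV[R]_1) : {for z, continuous (fun z : 'rV[R]_1 => flat l (z 0 0))}.
  apply: continuous_comp; first exact: coord_continuous.
  by apply: differentiable_continuous; apply/derivable1_diffP; case: (is_derive_flat l (z 0 0)).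
elim: k m => [|k IH] m; first by split=> // z _; exact: cfl.
split=> [z _|i]; first exact: cfl.
split=> [z _|]; first by case: (dfl m z i).
apply: (@eq_Ck _ _ _ _ ((fun z => (- m%:R) * flat m.+1 (z 0 0)) + (fun z => flat m.+2 (z 0 0)))).
- exact: openT.
- by move=> z _; case: (dfl m z i) => _ ->; rewrite fctE mulNr.
- apply: Ck_add; [exact: openT| |exact: IH].
  by apply: Ck_mul; [exact: openT|exact: Ck_cst|exact: IH].
Qed.

Lemma smooth_on_flat n (V : set 'rV[R]_n) (f : 'rV[R]_n -> R) m : open V ->
  smooth_on V f -> smooth_on V (fun z => flat m (f z)).
Proof.
move=> oV sf.
have := @smooth_on_comp R n 1 V setT (fun z => flat m (z 0 0)) (fun z => \row_(j < 1) f z).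
move=> /(_ oV openT (fun _ _ => I)) H.
rewrite (_ : (fun z => flat m (f z)) = fun z => flat m ((\row_(j < 1) f z) 0 0)).
  apply: H; last by move=> k; exact: Ck_flat.
  move=> j; rewrite (_ : (fun z => _) = f) //.
  by apply/funext => z; rewrite mxE.
by apply/funext => z; rewrite mxE.
Qed.

(** The function is u / (u + v), where u is positive exactly inside the Euclidean ball of radius r
    and v exactly outside the closed one of radius r / 2: it is 1 where v vanishes and 0 where u
    does. *)
Lemma smooth_bump n (V : set 'rV[R]_n) (a : 'rV[R]_n) : open V -> V a ->
  exists (phi : 'rV[R]_n -> R) (r : R), [/\ 0 < r, smooth_on setT phi,
    (\forall z \near a, phi z = 1),
    forall z, `|z - a| <= r -> V z &
    forall z, r < `|z - a| -> phi z = 0].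
Proof.
move=> oV Va.
have /nbhs_ballP[r0 /= r0_gt0 r0V] := open_nbhs_nbhs (conj oV Va).
(* Half of [r0], so that even the closed ball of radius r lies in V. *)
pose r := r0 / 2; have r_gt0 : 0 < r by rewrite divr_gt0.
(* The norm on rows is the sup norm, in general not smooth. The squared Euclidean distance q is
   smooth and dominates the square of the sup norm, so the bump vanishes outside the sup ball. *)
pose q (z : 'rV[R]_n) := \sum_i (z 0 i - a 0 i) * (z 0 i - a 0 i).
have sq : smooth_on setT q.
  have sd i : smooth_on setT (fun z : 'rV[R]_n => z 0 i - a 0 i).
    apply: smooth_onD; [exact: openT|exact: smooth_on_coord|exact: smooth_on_cst].
  by apply: smooth_on_sum => [|i]; [exact: openT|apply: smooth_onM => //; exact: openT].
pose u z := flat 0 (r ^+ 2 - q z); pose v z := flat 0 (q z - (r / 2) ^+ 2).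
have rr : (r / 2) ^+ 2 < r ^+ 2.
  by rewrite ltr_pXn2r ?nnegrE ?divr_ge0 ?ltW // ltr_pdivrMr // ltr_pMr // ltr1n.
have uv z : u z + v z != 0.
  rewrite gt_eqF //; have [qr|rq] := ltP (q z) (r ^+ 2).
    by rewrite ltr_wpDr ?flat_ge0 // flat_gt0 // subr_gt0.
  by rewrite ltr_wpDl ?flat_ge0 // flat_gt0 // subr_gt0 (lt_le_trans rr).
have su : smooth_on setT u.
  apply: smooth_on_flat; first exact: openT.
  apply: smooth_onD; [exact: openT|exact: smooth_on_cst|].
  by under eq_fun do rewrite -mulN1r; apply: smooth_onM; [exact: openT|exact: smooth_on_cst|].
have sv : smooth_on setT v.
  apply: smooth_on_flat; first exact: openT.
  by apply: smooth_onD; [exact: openT| |exact: smooth_on_cst].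
exists (fun z => u z * (u z + v z)^-1), r; split=> //.
- apply: smooth_onM => //; first exact: openT.
  by apply: smooth_on_inv; [exact: openT| |exact: smooth_onD openT _ _].
- have cq : {for a, continuous q} by have [+ _] := sq 0%N; apply.
  have q0 : q a = 0 by rewrite /q big1 // => i _; rewrite subrr mul0r.
  near=> z.
  suff v0 : v z = 0 by rewrite v0 addr0 divff //; have := uv z; rewrite v0 addr0.
  rewrite /v /flat ifF //; apply/negbTE; rewrite -leNgt subr_le0 ltW //.
  near: z; move/cvgrPdist_lt : cq => /(_ ((r / 2) ^+ 2)).
  rewrite exprn_gt0 ?divr_gt0 // => /(_ isT); apply: filterS => z.
  by rewrite q0 sub0r normrN; apply: le_lt_trans; exact: ler_norm.
- move=> z zr; apply: r0V; rewrite -ball_normE /= distrC (le_lt_trans zr) //.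
  by rewrite ltr_pdivrMr // ltr_pMr // ltr1n.
- move=> z rz; rewrite /u /flat ifF ?mul0r //; apply/negbTE.
  rewrite -leNgt subr_le0 leNgt; apply/negP => qr.
  move: rz; rewrite ltNge => /negP; apply; apply: ler_norm_rV; first exact: ltW.
  move=> i; rewrite !mxE -(@ler_pXn2r _ 2) ?nnegrE ?(ltW r_gt0) ?normr_ge0 // real_normK ?num_real //.
  apply: le_trans (ltW qr); rewrite /q (bigD1 i) //= -expr2 lerDl.
  by apply: sumr_ge0 => j _; rewrite -expr2 sqr_ge0.
Unshelve. all: by end_near. Qed.
End Flat.

(** * Changes of charts *)

Section ManifoldFacts.
Variables (R : realType) (n : nat) (M : smoothManifold R n).
Local Notation coord := Defs.coord.
Implicit Types (a b c : chart R n M) (x : M).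

Definition transition a b (z : 'rV[R]_n) : 'rV[R]_n := coord b (chart_inv a z).

Definition overlap a b : set 'rV[R]_n := coord a @` (chart_dom a `&` chart_dom b).

Lemma overlapP a b z : overlap a b z <->
  (coord a @` chart_dom a) z /\ chart_dom b (chart_inv a z).
Proof.
split=> [[x [ax bx] <-]|[[x ax <-]]]; first by rewrite coordK //; split=> //; exists x.
by rewrite coordK // => bx; exists x.
Qed.

Lemma open_preimage_chart a (U : set M) : open U ->
  open [set z | (coord a @` chart_dom a) z /\ U (chart_inv a z)].
Proof.
move=> oU; rewrite openE => z [[x ax <-]]; rewrite coordK // => Ux.
have Na : nbhs (coord a x) (coord a @` chart_dom a).
  by apply: open_nbhs_nbhs; split; [exact: chart_cod_open|exists x].
have NU : nbhs (coord a x) (chart_inv a @^-1` U).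
  by apply: (chart_inv_continuous ax); rewrite coordK //; exact: open_nbhs_nbhs.
by apply: filterS (filterI Na NU) => w [].
Qed.

Lemma open_overlap a b : open (overlap a b).
Proof.
rewrite (_ : overlap a b = [set z | (coord a @` chart_dom a) z /\ chart_dom b (chart_inv a z)]).
  exact/open_preimage_chart/chart_dom_open.
by apply/seteqP; split => z /overlapP.
Qed.

Lemma smooth_on_transition a b j : atlas a -> atlas b ->
  smooth_on (overlap a b) (fun z => transition a b z 0 j).
Proof. by move=> Aa Ab; exact: (atlas_compatible Aa Ab). Qed.

Lemma overlap_coord a b x : chart_dom a x -> chart_dom b x -> overlap a b (coord a x).
Proof. by move=> ax bx; exists x. Qed.

Lemma transition_coord a b x : chart_dom a x -> transition a b (coord a x) = coord b x.
Proof. by move=> ax; rewrite /transition coordK. Qed.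

Lemma transition_overlap a b z : overlap a b z -> overlap b a (transition a b z).
Proof. by move=> [x [ax bx] <-]; rewrite transition_coord //; exists x. Qed.

Lemma differentiable_transition a b z : atlas a -> atlas b -> overlap a b z ->
  differentiable (transition a b) z.
Proof.
move=> Aa Ab; apply: smooth_map_differentiable; first exact: open_overlap.
by move=> j; exact: smooth_on_transition.
Qed.

Lemma jacobian_transition a b c x : atlas a -> atlas b -> atlas c ->
  chart_dom a x -> chart_dom b x -> chart_dom c x ->
  'J (transition a c) (coord a x) =
  'J (transition a b) (coord a x) *m 'J (transition b c) (coord b x).
Proof.
move=> Aa Ab Ac ax bx cx.
have dab : differentiable (transition a b) (coord a x).
  exact/differentiable_transition/overlap_coord.
have dbc : differentiable (transition b c) (transition a b (coord a x)).
  by rewrite transition_coord //; exact/differentiable_transition/overlap_coord.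
rewrite -(transition_coord b ax) -(jacobian_comp dab dbc).
apply: near_eq_jacobian.
- exact/differentiable_transition/overlap_coord.
- exact: differentiable_comp.
- have : nbhs (coord a x) (overlap a b).
    by apply: open_nbhs_nbhs; split; [exact: open_overlap|exact: overlap_coord].
  apply: filterS => z [t [at_ bt] <-] /=.
  by rewrite !transition_coord.
Qed.

Lemma jacobian_transition_id a x : atlas a -> chart_dom a x ->
  'J (transition a a) (coord a x) = 1%:M.
Proof.
move=> Aa ax; rewrite -(jacobian_id (coord a x)); apply: near_eq_jacobian.
- exact/differentiable_transition/overlap_coord.
- by [].
- have : nbhs (coord a x) (overlap a a).
    by apply: open_nbhs_nbhs; split; [exact: open_overlap|exact: overlap_coord].
  apply: filterS => z [t [at_ _] <-] /=.
  by rewrite transition_coord.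
Qed.

(* Inverse to [tcoord_change x c]: from the coordinates of c to the reference
   coordinates at x. *)
Definition tcoord_back c x : 'M[R]_n := 'J (transition c (chart_at x)) (coord c x).

Lemma tcoord_back_change b c x : atlas b -> atlas c -> chart_dom b x -> chart_dom c x ->
  tcoord_back c x *m tcoord_change x b = 'J (transition c b) (coord c x).
Proof.
move=> Ab Ac bx cx; symmetry; apply: jacobian_transition => //.
  exact: chart_at_atlas.
exact: chart_at_dom.
Qed.

Lemma tcoord_change_back c x : atlas c -> chart_dom c x ->
  tcoord_change x c *m tcoord_back c x = 1%:M.
Proof.
move=> Ac cx; rewrite -(jacobian_transition_id (chart_at_atlas x) (chart_at_dom x)).
by symmetry; apply: jacobian_transition => //; (exact: chart_at_atlas || exact: chart_at_dom).
Qed.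

Lemma smooth_wprod (V : set 'rV[R]_n) (J : 'rV[R]_n -> 'M[R]_n) S T : open V ->
  (forall i j, smooth_on V (fun z => J z i j)) -> smooth_on V (fun z => wprod (J z) S T).
Proof.
move=> oV sJ; elim/set_ltn_ind: S T => [|m S mS IH] T.
  rewrite (_ : (fun _ => _) = fun=> ebas R finset.set0 T); first exact: smooth_on_cst.
  by apply/funext => z; rewrite /wprod -[enum _]/(enum finset.set0) enum_set0 big_nil.
rewrite (_ : (fun _ => _) = fun z => \sum_A \sum_B
   evec (row m (J z)) A * wprod (J z) S B * (esign R A B * ebas R (A :|: B) T)); last first.
  apply/funext => z; rewrite wprodU1 // /wedge sum_ffunE; apply: eq_bigr => A _.
  by rewrite sum_ffunE; apply: eq_bigr => B _; rewrite [LHS]ffunE [RHS]mulrA.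
apply: smooth_on_sum => // A; apply: smooth_on_sum => // B.
apply: smooth_onM => //; last exact: smooth_on_cst.
apply: smooth_onM => //.
rewrite (_ : (fun _ => _) = fun z => \sum_i J z m i * ebas R [set i]%SET A); last first.
  by apply/funext => z; rewrite /evec sum_ffunE; apply: eq_bigr => i _; rewrite ffunE mxE.
by apply: smooth_on_sum => // i; apply: smooth_onM => //; exact: smooth_on_cst.
Qed.

Lemma smooth_extmap (V : set 'rV[R]_n) (J : 'rV[R]_n -> 'M[R]_n) (w : 'rV[R]_n -> ext R n) T :
  open V -> (forall i j, smooth_on V (fun z => J z i j)) ->
  (forall S, smooth_on V (fun z => w z S)) -> smooth_on V (fun z => extmap (J z) (w z) T).
Proof.
move=> oV sJ sw.
rewrite (_ : (fun _ => _) = fun z => \sum_S w z S * wprod (J z) S T); last first.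
  by apply/funext => z; rewrite /extmap sum_ffunE; apply: eq_bigr => S _; rewrite ffunE.
by apply: smooth_on_sum => // S; apply: smooth_onM => //; exact: smooth_wprod.
Qed.

Lemma smooth_section_local (s : M -> ext R n) :
  (forall x, exists2 t, smooth_section t & \forall y \near x, s y = t y) ->
  smooth_section s.
Proof.
move=> H b Ab S; apply: smooth_on_local => _ [x bx <-].
have [t st N] := H x; have : nbhs x [set y | s y = t y] by exact: N.
rewrite nbhsE => -[U [oU Ux] UE].
exists [set z | (coord b @` chart_dom b) z /\ U (chart_inv b z)].
  by split; [exists x|rewrite coordK].
apply: (@eq_smooth_on _ _ _ (fun z => local_rep b t z S)).
- exact: open_preimage_chart.
- by move=> z [_ /UE E]; rewrite /local_rep E.
- by apply: smooth_onS (st b Ab S) => z [].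
Qed.

(** A field prescribed by its coordinates w in the chart c and cut off by phi; [tcoord_back]
    translates them to the reference chart at x, in which values at x are stored. *)
Definition extend c (phi : 'rV[R]_n -> R) (w : 'rV[R]_n -> ext R n) (x : M) : ext R n :=
  if `[< chart_dom c x >] then phi (coord c x) *: extmap (tcoord_back c x) (w (coord c x))
  else 0.

Lemma extendE c phi w x : chart_dom c x ->
  extend c phi w x = phi (coord c x) *: extmap (tcoord_back c x) (w (coord c x)).
Proof. by move=> cx; rewrite /extend; case: asboolP. Qed.

(** The reference chart may jump with x, but it cancels between [tcoord_back] and [tcoord_change].
    What is left is the Jacobian of a transition map, which is smooth. *)
Lemma local_rep_extend b c phi w x : atlas b -> atlas c -> chart_dom b x -> chart_dom c x ->
  local_rep b (extend c phi w) (coord b x) =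
  phi (coord c x) *: extmap ('J (transition c b) (coord c x)) (w (coord c x)).
Proof.
move=> Ab Ac bx cx; rewrite /local_rep (coordK bx) (extendE phi w cx).
exact: extmap_scale_comp (tcoord_back_change Ab Ac bx cx).
Qed.

Lemma smooth_extend c (phi : 'rV[R]_n -> R) (w : 'rV[R]_n -> ext R n) (z0 : 'rV[R]_n) (r : R) :
  atlas c -> 0 < r -> smooth_on setT phi ->
  (forall z, `|z - z0| <= r -> (coord c @` chart_dom c) z) ->
  (forall z, r < `|z - z0| -> phi z = 0) ->
  (forall S, smooth_on (coord c @` chart_dom c) (fun z => w z S)) ->
  smooth_section (extend c phi w).
Proof.
move=> Ac r0 sphi Vr phi0 sw b Ab S; apply: smooth_on_local => _ [x bx <-].
have [cx|cx] := pselect (chart_dom c x).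
  exists (overlap b c); first exact: overlap_coord.
  pose f z := phi z * extmap ('J (transition c b) z) (w z) S.
  apply: (@eq_smooth_on _ _ _ (fun z => f (transition b c z))).
  - exact: open_overlap.
  - move=> _ [y [by_ cy] <-]; rewrite transition_coord // /f.
    by rewrite (local_rep_extend phi w Ab Ac by_ cy) ext_scaleE.
  - apply: (@smooth_on_comp _ _ _ _ (overlap c b) f).
    + exact: open_overlap.
    + exact: open_overlap.
    + exact: transition_overlap.
    + by move=> j; exact: smooth_on_transition.
    + have oV := @open_overlap c b; apply: smooth_onM => //.
        exact: smooth_onS sphi.
      apply: smooth_extmap => //.
        by move=> i j; apply: smooth_on_jacobian => // k; exact: smooth_on_transition.
      by move=> T; apply: smooth_onS (sw T) => z /overlapP[].
(* Outside the chart: the ball B is compact, so its image K in M is compact, and closed because M is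
   Hausdorff. The complement of K is a neighbourhood of x on which the field is 0. *)
pose B := [set z : 'rV[R]_n | `|z - z0| <= r].
have cB : compact B.
  have cS i : compact [set` `[z0 ord0 i - r, z0 ord0 i + r]%R] by exact: segment_compact.
  have := rV_compact cS; congr compact; apply/seteqP; split=> z /= H.
    apply: ler_norm_rV => [|i]; last first.
      by have := H i; rewrite in_itv /= !mxE ler_distl.
    exact: ltW.
  move=> i; rewrite /= in_itv /= -ler_distl.
  by have := normr_entry (z - z0) i; rewrite !mxE => /le_trans; apply.
pose K := chart_inv c @` B.
have cK : closed K.
  apply: compact_closed; first exact: manifold_hausdorff.
  apply: continuous_compact => //; apply: continuous_in_subspaceT => z /set_mem/Vr[y cy <-].
  exact: chart_inv_continuous.
exists [set z | (coord b @` chart_dom b) z /\ (~` K) (chart_inv b z)].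
  split; first by exists x.
  by rewrite coordK // => -[z /Vr[y cy <-]]; rewrite coordK // => yx; rewrite yx in cy.
apply: (@eq_smooth_on _ _ _ (fun=> 0)).
- by apply: open_preimage_chart; rewrite openC.
- move=> _ [[y by_ <-]]; rewrite coordK // => yK; rewrite /local_rep coordK // /extend.
  case: asboolP => cy; last by rewrite extmap0 ffunE.
  rewrite phi0 ?scale0r ?extmap0 ?ffunE // ltNge; apply/negP => yr.
  by apply: yK; exists (coord c y) => //; rewrite coordK.
- exact: smooth_on_cst.
Qed.
End ManifoldFacts.

(** * Multivector fields and local frames *)

Section Multivectors.
Variables (R : realType) (n : nat) (M : smoothManifold R n).
Local Notation coord := Defs.coord.
Local Notation contract := (@Defs.contract R n).
Implicit Types (c : chart R n M) (x : M) (X Y Z : mvfield M).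

Lemma mvfield_eq X Y : (forall x, X x = Y x) -> X = Y.
Proof. by move=> E; apply/val_inj/funext. Qed.

Lemma mvD X Y x : (X + Y) x = X x + Y x. Proof. by []. Qed.
Lemma mvZ a X x : (a *: X) x = a *: X x. Proof. by []. Qed.
Lemma mv0 x : (0 : mvfield M) x = 0. Proof. by []. Qed.
Lemma mv_sum (I : Type) (r : seq I) (P : pred I) (F : I -> mvfield M) x :
  (\sum_(i <- r | P i) F i) x = \sum_(i <- r | P i) F i x.
Proof. by elim/big_rec2: _ => // i y1 y2 _ <-. Qed.

Lemma smooth_mvfield X : smooth_section X.
Proof. by have /asboolP := mvfieldP X. Qed.

Definition mkmv (s : M -> ext R n) (hs : smooth_section s) : mvfield M :=
  MVField (introT (asboolP _) hs : s \in @smooth_section_pred R n M).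

Lemma homogeneousP (k : nat) X : reflect (forall x, ehom k (X x)) (X \in @homogeneous _ _ M k%:Z).
Proof. by apply: (iffP (asboolP _)) => H x S Sk; exact: H. Qed.

Lemma Ak_ehom (k : nat) (X : Ak M k%:Z) x : ehom k (X x).
Proof. by have /homogeneousP := AkP X. Qed.

Definition mkAk (k : nat) X (hX : forall x, ehom k (X x)) : Ak M k%:Z :=
  MkAk (introT (homogeneousP k X) hX).

Lemma smooth_section_egr k X : smooth_section (fun x => egr k (X x)).
Proof.
move=> b Ab S.
have := smooth_onM (@chart_cod_open _ _ _ b) (smooth_on_cst (coord b @` chart_dom b) (#|S| == k)%:R)
  (smooth_mvfield X Ab S).
by congr smooth_on; apply/funext => z; rewrite /local_rep -egr_extmap ffunE.
Qed.

Definition mgr (k : nat) X : Ak M k%:Z :=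
  @mkAk k (mkmv (@smooth_section_egr k X)) (fun x => @egr_ehom _ _ k (X x)).

Lemma mgrE k X x : mgr k X x = egr k (X x). Proof. by []. Qed.

Lemma mgr_sum X : X = \sum_(k < n.+1) (mgr k X : mvfield M).
Proof. by apply: mvfield_eq => x; rewrite mv_sum {1}(egr_sum (X x)). Qed.

Section Frame.
Variables (c : chart R n M) (phi : 'rV[R]_n -> R) (z0 : 'rV[R]_n) (r : R).
Hypotheses (Ac : atlas c) (r0 : 0 < r) (sphi : smooth_on setT phi)
  (Vr : forall z, `|z - z0| <= r -> (coord c @` chart_dom c) z)
  (phi0 : forall z, r < `|z - z0| -> phi z = 0).

Lemma bump_fun_smooth : smooth_section (extend c (fun z => phi z * phi z)
  (fun=> ebas R finset.set0)).
Proof.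
apply: (@smooth_extend _ _ _ _ _ _ z0 r) => //.
- by apply: smooth_onM => //; exact: openT.
- by move=> z rz; rewrite phi0 // mul0r.
- by move=> S; exact: smooth_on_cst.
Qed.

Lemma bump_vec_smooth i : smooth_section (extend c phi (fun=> ebas R [set i]%SET)).
Proof.
by apply: (@smooth_extend _ _ _ _ _ _ z0 r) => // S; exact: smooth_on_cst.
Qed.

Lemma bump_contract_smooth i X :
  smooth_section (extend c phi (fun z => contract i (local_rep c X z))).
Proof.
apply: (@smooth_extend _ _ _ _ _ _ z0 r) => // S.
have := smooth_onM (@chart_cod_open _ _ _ c)
  (smooth_on_cst (coord c @` chart_dom c) (esign R [set i]%SET S)) (smooth_mvfield X Ac (i |: S)%SET).
by congr smooth_on; apply/funext => z; rewrite ffunE.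
Qed.

(** Reduces the frame identities to the exterior algebra at one point. Outside the chart, p = 0 with
    J = K = 1 describes the extension by zero, so both cases have the same form. *)
Lemma bump_pointwise x : exists (p : R) (J K : 'M[R]_n), [/\ J *m K = 1%:M,
  extend c (fun z => phi z * phi z) (fun=> ebas R finset.set0) x = (p * p) *: ebas R finset.set0,
  forall i, extend c phi (fun=> ebas R [set i]%SET) x = p *: extmap K (ebas R [set i]%SET) &
  forall i X, extend c phi (fun z => contract i (local_rep c X z)) x = fcontract J K p i (X x)].
Proof.
have [cx|cx] := pselect (chart_dom c x).
  exists (phi (coord c x)), (tcoord_change x c), (tcoord_back c x).
  split; first exact: tcoord_change_back.
  - by rewrite (extendE _ _ cx) extmap0set.
  - by move=> i; exact: extendE.
  - by move=> i X; rewrite (extendE _ _ cx) /local_rep coordK.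
have E f w : extend c f w x = 0 by rewrite /extend; case: asboolP.
exists 0, 1%:M, 1%:M; split; first exact: mulmx1.
- by rewrite E mul0r scale0r.
- by move=> i; rewrite E scale0r.
- by move=> i X; rewrite E /fcontract scale0r.
Qed.
End Frame.

(* Near the points where the function [fr_fun] is 1, the [fr_vec i] form a local
   frame of TM and the [fr_con i] are the contractions with the dual coframe. *)
Record frame := Frame {
  fr_fun : Ak M 0;
  fr_vec : 'I_n -> Ak M 1;
  fr_con : 'I_n -> mvfield M -> mvfield M;
  fr_con_lin : forall i (a : R) X Y, fr_con i (a *: X + Y) = a *: fr_con i X + fr_con i Y;
  fr_con_degree : forall i (k : nat) (X : Ak M k.+1), fr_con i X \in @homogeneous _ _ M k;
  fr_con_degree0 : forall i (f : Ak M 0), fr_con i f = 0;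
  fr_con_wedge : forall i (k : nat) (X : Ak M k) Y,
    fr_con i (mwedge X Y) = mwedge (fr_con i X) Y + (-1) ^+ k *: mwedge X (fr_con i Y);
  fr_euler : forall (k : nat) (X : Ak M k),
    \sum_i mwedge (fr_vec i) (fr_con i X) = k%:R *: mwedge fr_fun X }.

Lemma frame_exists x0 : exists fr : frame,
  \forall x \near x0, fr_fun fr x = ebas R finset.set0.
Proof.
pose c := chart_at x0.
have Ac : atlas c := chart_at_atlas x0.
have cx0 : chart_dom c x0 := chart_at_dom x0.
have Vz0 : (coord c @` chart_dom c) (coord c x0) by exists x0.
have [phi [r [r0 sphi phi1 Vr phi0]]] := smooth_bump (@chart_cod_open _ _ _ c) Vz0.
pose PW := bump_pointwise phi Ac.
pose sf := bump_fun_smooth Ac r0 sphi Vr phi0.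
pose sv i := bump_vec_smooth Ac r0 sphi Vr phi0 i.
pose sc i X := bump_contract_smooth Ac r0 sphi Vr phi0 i X.
have hf x : ehom 0 (mkmv sf x).
  have [p [J [K [_ E _ _]]]] := PW x; rewrite [mkmv _ _]E.
  exact/ehomZ/ehom_set0.
have hv i x : ehom 1 (mkmv (sv i) x).
  have [p [J [K [_ _ E _]]]] := PW x; rewrite [mkmv _ _]E.
  by apply/ehomZ/ehom_extmap; rewrite -(cards1 i); exact: ehom_ebas.
have @fr : frame.
  apply: (@Frame (@mkAk 0 _ hf) (fun i => @mkAk 1 _ (hv i)) (fun i X => mkmv (sc i X))).
  - move=> i a X Y; apply: mvfield_eq => x; have [p [J [K [_ _ _ E]]]] := PW x.
    have E' X' : mkmv (sc i X') x = fcontract J K p i (X' x) := E i X'.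
    change (mkmv (sc i (a *: X + Y)) x = a *: mkmv (sc i X) x + mkmv (sc i Y) x).
    by rewrite !E'; exact: (fcontract_lin J K p i a (X x) (Y x)).
  - move=> i k X; apply/homogeneousP => x; have [p [J [K [_ _ _ E]]]] := PW x.
    by rewrite [mkmv _ _]E; apply: fcontract_ehom; exact: Ak_ehom.
  - move=> i f; apply: mvfield_eq => x; have [p [J [K [_ _ _ E]]]] := PW x.
    by rewrite [mkmv _ _]E; apply: fcontract_ehom0; exact: (@Ak_ehom 0).
  - move=> i k X Y; apply: mvfield_eq => x; have [p [J [K [JK _ _ E]]]] := PW x.
    have E' X' : mkmv (sc i X') x = fcontract J K p i (X' x) := E i X'.
    change (mkmv (sc i (mwedge X Y)) x =
      wedge (mkmv (sc i X) x) (Y x) + (-1) ^+ k *: wedge (X x) (mkmv (sc i Y) x)).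
    by rewrite !E'; exact: (fcontract_wedge _ _ _ JK (@Ak_ehom k X x)).
  - move=> k X; apply: mvfield_eq => x; have [p [J [K [JK Ef Ev E]]]] := PW x.
    rewrite mv_sum mvZ /= Ef -(euler_fcontract p JK (@Ak_ehom k X x)).
    by apply: eq_bigr => i _; rewrite /= Ev E.
exists fr.
have cc : {for x0, continuous (coord c)} := Defs.coord_continuous cx0.
have Nc : \forall x \near x0, chart_dom c x.
  by apply: open_nbhs_nbhs; split; [exact: chart_dom_open|].
have Np : \forall x \near x0, phi (coord c x) = 1 := cc _ phi1.
apply: filterS (filterI Nc Np) => x [cx p1].
by rewrite [LHS](extendE _ _ cx) p1 mulr1 scale1r extmap0set.
Qed.
End Multivectors.

Lemma sum_only (V : nmodType) (I : finType) (F : I -> V) (i : I) :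
  (forall j, j != i -> F j = 0) -> \sum_j F j = F i.
Proof. by move=> F0; rewrite (bigD1 i) //= big1 // addr0. Qed.

(** * The graded algebra of multivector fields *)

Section MultivectorAlgebra.
Variables (R : realType) (n : nat) (M : smoothManifold R n).
Implicit Types (x : M) (X Y Z : mvfield M) (f g : Ak M 0).

Lemma mwE X Y x : mwedge X Y x = wedge (X x) (Y x). Proof. by []. Qed.

Lemma mwedgeA X Y Z : mwedge X (mwedge Y Z) = mwedge (mwedge X Y) Z.
Proof. by apply: mvfield_eq => x; rewrite !mwE wedgeA. Qed.

Lemma mwedgeDl X Y Z : mwedge (X + Y) Z = mwedge X Z + mwedge Y Z.
Proof. by apply: mvfield_eq => x; rewrite mvD !mwE mvD wedgeDl. Qed.

Lemma mwedgeDr X Y Z : mwedge Z (X + Y) = mwedge Z X + mwedge Z Y.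
Proof. by apply: mvfield_eq => x; rewrite mvD !mwE mvD wedgeDr. Qed.

Lemma mwedgeZl a X Z : mwedge (a *: X) Z = a *: mwedge X Z.
Proof. by apply: mvfield_eq => x; rewrite mvZ !mwE mvZ wedgeZl. Qed.

Lemma mwedgeZr a X Z : mwedge Z (a *: X) = a *: mwedge Z X.
Proof. by apply: mvfield_eq => x; rewrite mvZ !mwE mvZ wedgeZr. Qed.

Lemma mwedge0l X : mwedge 0 X = 0.
Proof. by apply: mvfield_eq => x; rewrite mwE mv0 wedge0l. Qed.

Lemma mwedge0r X : mwedge X 0 = 0.
Proof. by apply: mvfield_eq => x; rewrite mwE mv0 wedge0r. Qed.

Lemma mwedgeNl X Z : mwedge (- X) Z = - mwedge X Z.
Proof. by rewrite -scaleN1r mwedgeZl scaleN1r. Qed.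

Lemma mwedgeNr X Z : mwedge Z (- X) = - mwedge Z X.
Proof. by rewrite -scaleN1r mwedgeZr scaleN1r. Qed.

Lemma mwedge_suml (I : Type) (r : seq I) (F : I -> mvfield M) X :
  mwedge (\sum_(i <- r) F i) X = \sum_(i <- r) mwedge (F i) X.
Proof.
by apply: (big_morph (fun Y => mwedge Y X)) => [u v|]; rewrite ?mwedgeDl ?mwedge0l.
Qed.

Lemma mwedge_sumr (I : Type) (r : seq I) (F : I -> mvfield M) X :
  mwedge X (\sum_(i <- r) F i) = \sum_(i <- r) mwedge X (F i).
Proof.
by apply: (big_morph (mwedge X)) => [u v|]; rewrite ?mwedgeDr ?mwedge0r.
Qed.

Lemma mwedge_degree (k l : nat) X Y : X \in @homogeneous R n M k -> Y \in @homogeneous R n M l ->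
  mwedge X Y \in @homogeneous R n M (k + l)%N.
Proof.
by move=> /homogeneousP hX /homogeneousP hY; apply/homogeneousP => x; exact: ehom_wedge.
Qed.

Lemma mwedge_anticomm (k l : nat) X Y : X \in @homogeneous R n M k -> Y \in @homogeneous R n M l ->
  mwedge X Y = (-1) ^+ (k * l) *: mwedge Y X.
Proof.
move=> /homogeneousP hX /homogeneousP hY; apply: mvfield_eq => x.
by rewrite mvZ !mwE; exact: wedge_anticomm.
Qed.

Lemma mwedgefC (f : Ak M 0) X : mwedge f X = mwedge X f.
Proof.
apply: mvfield_eq => x; rewrite !mwE wedge_ehom0; last exact: (@Ak_ehom _ _ _ 0).
by rewrite [in RHS](ehom0E (@Ak_ehom _ _ _ 0 f x)) wedgeZr wedge1r.
Qed.

Lemma mwedgefA (f : Ak M 0) X Y : mwedge X (mwedge f Y) = mwedge f (mwedge X Y).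
Proof. by rewrite !mwedgeA -mwedgefC. Qed.

Lemma Ak_eq (k : int) (X Y : Ak M k) : X = Y :> mvfield M -> X = Y.
Proof. exact: val_inj. Qed.

Lemma Ak_valD (k : int) (X Y : Ak M k) : Ak_val (X + Y) = Ak_val X + Ak_val Y.
Proof. by []. Qed.

Lemma Ak_val_sum (k : int) (I : Type) (r : seq I) (F : I -> Ak M k) :
  Ak_val (\sum_(i <- r) F i) = \sum_(i <- r) Ak_val (F i).
Proof. by elim/big_rec2: _ => // i y1 y2 _ <-. Qed.

Lemma smooth_section1 : smooth_section (fun _ : M => ebas R finset.set0).
Proof.
move=> b Ab S; rewrite (_ : (fun _ => _) = fun=> ebas R finset.set0 S).
  exact: smooth_on_cst.
by apply/funext => z; rewrite /local_rep extmap0set.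
Qed.

Definition mone : Ak M 0 :=
  @mkAk _ _ M 0 (mkmv smooth_section1) (fun=> @ehom_set0 R n).

Lemma mwedge1l X : mwedge mone X = X.
Proof. by apply: mvfield_eq => x; rewrite mwE wedge1l. Qed.

Lemma fscaleE (k : int) f (X : Ak M k) : fscale f X = mwedge f X :> mvfield M.
Proof. by []. Qed.

Lemma fscale1 (k : int) (X : Ak M k) : fscale mone X = X.
Proof. by apply: Ak_eq; rewrite fscaleE mwedge1l. Qed.

Lemma mgr_id (k : nat) (X : Ak M k) : mgr k X = X.
Proof. by apply: Ak_eq; apply: mvfield_eq => x; rewrite mgrE; exact/egr_id/Ak_ehom. Qed.

Lemma mgr_other (k l : nat) (X : Ak M l) : l != k -> mgr k X = 0.
Proof.
by move=> lk; apply: Ak_eq; apply: mvfield_eq => x; rewrite mgrE; exact: egr_other (@Ak_ehom _ _ _ _ X x) lk.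
Qed.

Lemma mgr_flin (k : nat) f X Y : mgr k (mwedge f X + Y) = fscale f (mgr k X) + mgr k Y.
Proof.
apply: Ak_eq; apply: mvfield_eq => x; rewrite Ak_valD mvD fscaleE mwE !mgrE mvD mwE.
by rewrite !wedge_ehom0 ?egr_lin //; exact: (@Ak_ehom _ _ _ 0).
Qed.

Lemma mgrD (k : nat) X Y : mgr k (X + Y) = mgr k X + mgr k Y.
Proof. by have := mgr_flin k mone X Y; rewrite mwedge1l fscale1. Qed.

Lemma mgr0 (k : nat) : mgr k (0 : mvfield M) = 0.
Proof.
apply: Ak_eq; apply: mvfield_eq => x; rewrite mgrE.
by apply/ffunP => S; rewrite !ffunE mulr0.
Qed.

Lemma homogeneous_gt (k : nat) X : (n < k)%N -> X \in @homogeneous R n M k -> X = 0.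
Proof.
move=> nk /homogeneousP hX; apply: mvfield_eq => x; apply/ffunP => S; rewrite hX ?ffunE //.
apply: contraTneq nk => <-; rewrite -leqNgt.
by rewrite -[n in (_ <= n)%N]card_ord max_card.
Qed.

(** Every field is the finite sum of its homogeneous components; this passes from the axioms, mostly
    stated in fixed degrees, to arbitrary fields. *)
Lemma mv_additive_eq (V : zmodType) (g g' : mvfield M -> V) :
  (forall X Y, g (X + Y) = g X + g Y) -> (forall X Y, g' (X + Y) = g' X + g' Y) ->
  (forall (k : nat) (X : Ak M k), g X = g' X) -> g =1 g'.
Proof.
move=> gD g'D E X.
have add0 (h : mvfield M -> V) : (forall X Y, h (X + Y) = h X + h Y) -> h 0 = 0.
  by move=> hD; have /eqP := hD 0 0; rewrite addr0 -subr_eq subrr eq_sym => /eqP.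
rewrite (mgr_sum X) (big_morph g gD (add0 _ gD)) (big_morph g' g'D (add0 _ g'D)).
by apply: eq_bigr => k _.
Qed.

Lemma sgn_nat (m : nat) : sgn R m%:Z = (-1) ^+ m. Proof. by []. Qed.

Lemma sgnM_pred (k l : nat) : sgn R ((k.+1%:Z - 1) * l%:Z) = (-1) ^+ (k * l).
Proof. by rewrite -sgn_nat PoszM -addn1 PoszD addrK. Qed.

End MultivectorAlgebra.

(** * Pointwise uniqueness of the induced connection *)

Section Connections.
Variables (R : realType) (n : nat) (M : smoothManifold R n).
Variables (br : mvfield M -> mvfield M -> mvfield M) (hbr : schouten_bracket br).
Implicit Types (x y : M) (X Y Z : mvfield M) (f g : Ak M 0) (E : Ak M 1) (fr : frame M).

Lemma sgnE (e : int) : sgn R e = (-1) ^+ `|e|%N.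
Proof. by case: e => [//|m]; rewrite /sgn -[LHS]exprVn invrN1. Qed.

Lemma sgn_opp (e : int) : sgn R (- e) = sgn R e.
Proof. by rewrite !sgnE abszN. Qed.

Lemma sgn_pred (k : nat) : sgn R (k%:Z - 1) = - (-1) ^+ k.
Proof.
case: k => [|k]; first by rewrite sub0r sgn_opp expr0.
by rewrite exprS mulN1r opprK -sgn_nat -addn1 PoszD addrK.
Qed.

Lemma brDl X X' Y : br (X + X') Y = br X Y + br X' Y.
Proof. by have := schouten_linl hbr 1 X X' Y; rewrite !scale1r. Qed.

Lemma brDr X Y Y' : br X (Y + Y') = br X Y + br X Y'.
Proof. by have := schouten_linr hbr 1 X Y Y'; rewrite !scale1r. Qed.

Lemma br0l Y : br 0 Y = 0.
Proof. by have /eqP := brDl 0 0 Y; rewrite addr0 -subr_eq subrr eq_sym => /eqP. Qed.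

Lemma br_fun_r (k : nat) (X : Ak M k) f : br X f = (-1) ^+ k *: br f X.
Proof.
rewrite (schouten_anti hbr (p := k) (q := 0) X f) sub0r mulrN1 sgn_opp sgn_pred.
by rewrite scaleNr opprK.
Qed.

(** The Leibniz rule is given in the second argument. Antisymmetry carries it to the first, where
    [g, f] = 0 removes the derivative term. *)
Lemma br_funl (k : nat) f (X : Ak M k) g : br (mwedge f X) g = mwedge f (br X g).
Proof.
rewrite -[mwedge f X]/(Ak_val (fscale f X)) !br_fun_r /=.
rewrite (schouten_leibniz hbr (p := 0) (q := 0) g f X) (schouten_fun hbr) mwedge0l add0r.
by rewrite mulr0 sgn_nat expr0 scale1r mwedgeZr.
Qed.

(** The bracket with a function obeys the product rule in X that is demanded of an induced
    connection; [frame_conn_at] uses this to identify the derivatives of functions in all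
    degrees. *)
Lemma br_wedge_fun (k : nat) E (X : Ak M k) f :
  br (mwedge E X) f = mwedge E (br X f) + (-1) ^+ k *: mwedge X (br E f).
Proof.
have hW : mwedge E X \in @homogeneous R n M k.+1.
  by apply: (@mwedge_degree _ _ _ 1 k); exact: AkP.
have hEf : br E f \in @homogeneous R n M 0.
  by have := schouten_degree hbr (k := 1) (l := 0) E f.
have cEf : mwedge X (br E f) = mwedge (br E f) X by symmetry; exact: (mwedgefC (MkAk hEf)).
have := @br_fun_r k.+1 (MkAk hW) f => /= ->.
rewrite (schouten_leibniz hbr (p := 0) (q := 1) f E X) cEf.
rewrite (@br_fun_r 1 E f) (@br_fun_r k X f) expr1 scaleN1r.
rewrite sub0r mulN1r sgn_opp sgn_nat expr1 scaleN1r.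
by rewrite mwedgeNl mwedgeZr exprS mulN1r scaleNr scalerBr opprB scalerN.
Qed.

Lemma br_derivation (l : nat) E (Y : Ak M l) Z :
  br E (mwedge Y Z) = mwedge (br E Y) Z + mwedge Y (br E Z).
Proof.
by rewrite (schouten_leibniz hbr (p := 1) (q := l) E Y Z) subrr mul0r sgn_nat expr0 scale1r.
Qed.

Lemma br_degree1 (l : nat) E (Y : Ak M l) : br E Y \in @homogeneous R n M l.
Proof.
by have := schouten_degree hbr (k := 1) (l := l) E Y; rewrite [1%:Z + _]addrC addrK.
Qed.

(* The axioms of the induced higher connection of A, for the values at y only. *)
Record conn_at (A : affine_connection M) (y : M) (d : mvfield M -> mvfield M -> ext R n) : Prop := {
  ca_addl : forall X X' Z, d (X + X') Z = d X Z + d X' Z;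
  ca_addr : forall X Z Z', d X (Z + Z') = d X Z + d X Z';
  ca_fun0 : forall f Z, d f Z = 0;
  ca_funr : forall (k : nat) (X : Ak M k) f, d X f = br X f y;
  ca_agree : forall X Y : Ak M 1, d X Y = A X Y y;
  ca_wedgel : forall (k l : nat) (X : Ak M k) (Y : Ak M l) Z,
    d (mwedge X Y) Z = wedge (X y) (d Y Z) + sgn R (k%:Z * l%:Z) *: wedge (Y y) (d X Z);
  ca_wedger : forall (k l : nat) (X : Ak M k) (Y : Ak M l) Z,
    d X (mwedge Y Z) = wedge (d X Y) (Z y) + sgn R ((k%:Z - 1) * l%:Z) *: wedge (Y y) (d X Z) }.

(* By Euler's identity [fr_euler], every field of degree k > 1 is, up to the
   functions [fr_fun] and k, a sum of products of fields of lower degree. *)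
Lemma frame_induct fr (g1 g2 : mvfield M -> ext R n) :
  (forall X Y, g1 (X + Y) = g1 X + g1 Y) -> (forall X Y, g2 (X + Y) = g2 X + g2 Y) ->
  (forall (k : nat) (X : Ak M k), g1 (mwedge (fr_fun fr) X) = g2 (mwedge (fr_fun fr) X) ->
    g1 X = g2 X) ->
  (forall f, g1 f = g2 f) -> (forall E, g1 E = g2 E) ->
  (forall (k : nat) E (X : Ak M k), g1 X = g2 X -> g1 (mwedge E X) = g2 (mwedge E X)) ->
  forall (k : nat) (X : Ak M k), g1 X = g2 X.
Proof.
move=> g1D g2D canc g_fun g_vec g_wedge.
have add0 (h : mvfield M -> ext R n) : (forall X Y, h (X + Y) = h X + h Y) -> h 0 = 0.
  by move=> hD; have /eqP := hD 0 0; rewrite addr0 -subr_eq subrr eq_sym => /eqP.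
have addMn (h : mvfield M -> ext R n) m X :
    (forall X Y, h (X + Y) = h X + h Y) -> h (m%:R *: X) = m%:R *: h X.
  move=> hD; elim: m => [|m IH]; first by rewrite !scale0r add0.
  by rewrite -add1n !natrD !scalerDl hD IH !scale1r.
case=> [X|]; first exact: g_fun.
elim=> [X|k IH X]; first exact: g_vec.
apply: canc; have k0 : k.+2%:R != 0 :> R by rewrite pnatr_eq0.
apply: (scalerI k0); rewrite -(addMn g1) // -(addMn g2) // -fr_euler.
rewrite (big_morph g1 g1D (add0 _ g1D)) (big_morph g2 g2D (add0 _ g2D)).
apply: eq_bigr => i _.
by apply: (g_wedge k.+1 _ (MkAk (fr_con_degree fr i X))); exact: IH.
Qed.

(** Two passes of [frame_induct]: in Z with X a vector field, then in X, where the first pass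
    supplies the vector factor split off from X. Additivity handles inhomogeneous fields. *)
Lemma conn_at_unique A y d1 d2 fr : fr_fun fr y = ebas R finset.set0 ->
  conn_at A y d1 -> conn_at A y d2 -> forall X Z, d1 X Z = d2 X Z.
Proof.
move=> fr1 h1 h2.
have H1 E (k : nat) (Z : Ak M k) : d1 E Z = d2 E Z.
  apply: (@frame_induct fr (d1 E) (d2 E)) => //.
  - exact: (ca_addr h1).
  - exact: (ca_addr h2).
  (* The product rule produces the bracket of E with the frame function, wedged with Y, the same for
     both operators. Once it is cancelled, the value 1 of that function at y leaves the two
     derivatives of Y. *)
  - move=> l Y; rewrite (ca_wedger h1 (k := 1) (l := 0)) (ca_wedger h2 (k := 1) (l := 0)).
    rewrite (ca_funr h1 (k := 1)) (ca_funr h2 (k := 1)) => /addrI.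
    by rewrite mulr0 sgn_nat expr0 !scale1r fr1 !wedge1l.
  - by move=> f; rewrite (ca_funr h1 (k := 1)) (ca_funr h2 (k := 1)).
  - by move=> E'; rewrite (ca_agree h1) (ca_agree h2).
  - move=> l E' Y EY; rewrite (ca_wedger h1 (k := 1) (l := 1)) (ca_wedger h2 (k := 1) (l := 1)).
    by rewrite EY (ca_agree h1) (ca_agree h2).
have H2 (k l : nat) (X : Ak M k) (Z : Ak M l) : d1 X Z = d2 X Z.
  apply: (@frame_induct fr (d1^~ Z) (d2^~ Z)) => //.
  - by move=> X1 X2; exact: (ca_addl h1).
  - by move=> X1 X2; exact: (ca_addl h2).
  - move=> m Y; rewrite (ca_wedgel h1 (k := 0)) (ca_wedgel h2 (k := 0)).
    by rewrite (ca_fun0 h1) (ca_fun0 h2) !wedge0r scaler0 !addr0 fr1 !wedge1l.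
  - by move=> f; rewrite (ca_fun0 h1) (ca_fun0 h2).
  - by move=> m E Y EY; rewrite (ca_wedgel h1 (k := 1)) (ca_wedgel h2 (k := 1)) EY H1.
move=> X Z; apply: (@mv_additive_eq _ _ _ _ (d1^~ Z) (d2^~ Z)).
- by move=> X1 X2; exact: (ca_addl h1).
- by move=> X1 X2; exact: (ca_addl h2).
move=> k {}X; apply: (@mv_additive_eq _ _ _ _ (d1 X) (d2 X)).
- exact: (ca_addr h1).
- exact: (ca_addr h2).
- by move=> l {}Z; exact: H2.
Qed.

End Connections.

(** * Existence of the induced connection *)

Section Induced.
Variables (R : realType) (n : nat) (M : smoothManifold R n).
Variables (br : mvfield M -> mvfield M -> mvfield M) (hbr : schouten_bracket br).
Variable A : affine_connection M.
Implicit Types (x y : M) (X Y Z : mvfield M) (f g : Ak M 0) (E : Ak M 1).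

Lemma scaleCA_mv (a b : R) X : a *: (b *: X) = b *: (a *: X).
Proof. by rewrite !scalerA mulrC. Qed.

(** The grade involution on fields; it turns the degree-dependent sign in [frame_conn] into an
    additive operation. *)
Definition mginv X : mvfield M := \sum_(k < n.+1) (-1) ^+ k *: (mgr k X : mvfield M).

Lemma mginvD X Y : mginv (X + Y) = mginv X + mginv Y.
Proof. by rewrite -big_split; apply: eq_bigr => k _; rewrite mgrD Ak_valD scalerDr. Qed.

Lemma mginvE (k : nat) (X : Ak M k) : mginv X = (-1) ^+ k *: (X : mvfield M).
Proof.
have [kn|nk] := ltnP k n.+1; last first.
  rewrite (homogeneous_gt nk (AkP X)) scaler0 /mginv big1 // => j _.
  by rewrite mgr0 scaler0.
rewrite /mginv (@sum_only _ _ _ (Ordinal kn)) => [|j jk]; first by rewrite (mgr_id X).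
rewrite mgr_other ?scaler0 //; apply: contraNneq jk => kj.
by apply/eqP/val_inj.
Qed.

Lemma affine_addl (X X' Y : Ak M 1) : A (X + X') Y = A X Y + A X' Y.
Proof. by have := affine_linl A (mone M) X X' Y; rewrite !fscale1. Qed.

Lemma affine0l (Y : Ak M 1) : A 0 Y = 0.
Proof. by have /eqP := affine_addl 0 0 Y; rewrite addr0 -subr_eq subrr eq_sym => /eqP. Qed.

Lemma affine_scalel f (X Y : Ak M 1) : A (fscale f X) Y = fscale f (A X Y).
Proof. by have := affine_linl A f X 0 Y; rewrite affine0l !addr0. Qed.

(** Not the torsion tensor, which would also subtract the derivative of E along E'. Only the
    dependence on E' is C^oo-linear, because A and the bracket share the derivative term; this
    suffices, as [cov] takes a frame vector for E. *)
Definition torsion E E' : mvfield M := (A E E' : mvfield M) - br E E'.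

Lemma torsion_degree E E' : torsion E E' \in @homogeneous R n M 1.
Proof. by rewrite rpredB //; [exact: AkP|exact: (br_degree1 hbr (l := 1))]. Qed.

Lemma torsion_addr E E1 E2 : torsion E (E1 + E2) = torsion E E1 + torsion E E2.
Proof. by rewrite /torsion affine_addr !Ak_valD (brDr hbr) opprD addrACA. Qed.

Lemma torsion0r E : torsion E 0 = 0.
Proof. by have /eqP := torsion_addr E 0 0; rewrite addr0 -subr_eq subrr eq_sym => /eqP. Qed.

Lemma torsion_scaler f E E' : torsion E (fscale f E') = mwedge f (torsion E E').
Proof.
have AE : A E (fscale f E') = mwedge (br E f) E' + mwedge f (A E E') :> mvfield M.
  by apply: mvfield_eq => x; rewrite affine_leibniz mvD !mwE (schouten_lie hbr).
rewrite /torsion AE fscaleE (br_derivation hbr (l := 0)) mwedgeDr mwedgeNr.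
by rewrite opprD addrACA subrr add0r.
Qed.

Section WithFrame.
Variable fr : frame M.
Notation phi := (fr_fun fr).
Notation e := (fr_vec fr).
Notation con := (fr_con fr).

Lemma conD i X Y : con i (X + Y) = con i X + con i Y.
Proof. by have := fr_con_lin fr i 1 X Y; rewrite !scale1r. Qed.

Lemma con0 i : con i 0 = 0.
Proof. exact: (fr_con_degree0 fr i 0). Qed.

Lemma conZ i a X : con i (a *: X) = a *: con i X.
Proof. by have := fr_con_lin fr i a X 0; rewrite con0 !addr0. Qed.

Lemma con_degree i (k : nat) (X : Ak M k.+1) : con i X \in @homogeneous R n M k.
Proof. exact: fr_con_degree. Qed.

(* phi times the covariant derivative along e i: the Lie derivative along e i,
   corrected by the derivation extending the tensor [torsion (e i)]. *)
Definition cov i Z : mvfield M :=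
  mwedge phi (br (e i) Z) + \sum_j mwedge (torsion (e i) (e j)) (con j Z).

Lemma covD i X Y : cov i (X + Y) = cov i X + cov i Y.
Proof.
rewrite /cov brDr // mwedgeDr addrACA -big_split; congr (_ + _).
by apply: eq_bigr => j _; rewrite conD mwedgeDr.
Qed.

Lemma cov_fun i f : cov i f = mwedge phi (br (e i) f).
Proof.
by rewrite /cov big1 ?addr0 // => j _; rewrite fr_con_degree0 mwedge0r.
Qed.

Lemma cov_degree i (l : nat) (Z : Ak M l) : cov i Z \in @homogeneous R n M l.
Proof.
rewrite rpredD //.
  by apply: (@mwedge_degree _ _ _ 0 l); [exact: AkP|exact: br_degree1].
rewrite rpred_sum // => j _; case: l Z => [|l] Z.
  by rewrite (fr_con_degree0 fr j Z) mwedge0r rpred0.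
by apply: (@mwedge_degree _ _ _ 1 l); [exact: torsion_degree|exact: con_degree].
Qed.

(** Both terms of [cov] are derivations of degree 0. In the second one, moving Y across the
    degree-one factor [torsion] cancels the sign (-1)^l that the contraction acquires across Y. *)
Lemma cov_wedge i (l : nat) (Y : Ak M l) Z :
  cov i (mwedge Y Z) = mwedge (cov i Y) Z + mwedge Y (cov i Z).
Proof.
rewrite /cov (br_derivation hbr) mwedgeDr !mwedgeDl mwedgeDr mwedgeA (mwedgefA phi) -!addrA.
congr (_ + _); rewrite [RHS]addrCA; congr (_ + _).
rewrite mwedge_suml mwedge_sumr -big_split; apply: eq_bigr => j _ /=.
rewrite fr_con_wedge mwedgeDr mwedgeA; congr (_ + _).
have -> : mwedge Y (mwedge (torsion (e i) (e j)) (con j Z)) =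
          (-1) ^+ l *: mwedge (torsion (e i) (e j)) (mwedge Y (con j Z)).
  by rewrite !mwedgeA (mwedge_anticomm (AkP Y) (torsion_degree _ _)) muln1 mwedgeZl.
by rewrite mwedgeZr.
Qed.

(** In degree k > 0 the sign is (-1)^(k-1): contraction removes a factor from the left of X, whereas
    the derivative along that factor stands to the right of the other k - 1 factors. *)
Definition frame_conn X Z : mvfield M := - \sum_i mwedge (con i (mginv X)) (cov i Z).
Notation G := frame_conn.

Lemma frame_connE (k : nat) (X : Ak M k) Z :
  G X Z = (-1) ^+ k.+1 *: \sum_i mwedge (con i X) (cov i Z).
Proof.
rewrite /G exprS mulN1r scaleNr; congr (- _); rewrite scaler_sumr; apply: eq_bigr => i _.
by rewrite mginvE conZ mwedgeZl.
Qed.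

Lemma frame_conn_addl X X' Z : G (X + X') Z = G X Z + G X' Z.
Proof.
rewrite /G -opprD -big_split; congr (- _); apply: eq_bigr => i _.
by rewrite mginvD conD mwedgeDl.
Qed.

Lemma frame_conn_addr X Z Z' : G X (Z + Z') = G X Z + G X Z'.
Proof.
rewrite /G -opprD -big_split; congr (- _); apply: eq_bigr => i _.
by rewrite covD mwedgeDr.
Qed.

Lemma frame_conn_fun0 f Z : G f Z = 0.
Proof.
rewrite (@frame_connE 0) big1 ?scaler0 // => i _.
by rewrite fr_con_degree0 mwedge0l.
Qed.

Lemma frame_conn_degree (k l : nat) (X : Ak M k) (Z : Ak M l) :
  G X Z \in @homogeneous R n M (k%:Z + l%:Z - 1).
Proof.
case: k X => [|k] X; first by rewrite (@frame_conn_fun0 X) rpred0.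
rewrite frame_connE rpredZ // rpred_sum // => i _.
rewrite (_ : _ - 1 = (k + l)%N%:Z); first by apply: mwedge_degree; [exact: con_degree|exact: cov_degree].
by rewrite -addn1 !PoszD addrAC addrK.
Qed.

Lemma frame_conn_wedger (k l : nat) (X : Ak M k) (Y : Ak M l) Z :
  G X (mwedge Y Z) = mwedge (G X Y) Z + sgn R ((k%:Z - 1) * l%:Z) *: mwedge Y (G X Z).
Proof.
case: k X => [|k] X.
  by rewrite !(@frame_conn_fun0 X) mwedge0l mwedge0r scaler0 addr0.
rewrite sgnM_pred !frame_connE mwedgeZl mwedgeZr (scaleCA_mv _ ((-1) ^+ k.+2)) -scalerDr.
congr (_ *: _); rewrite mwedge_suml mwedge_sumr scaler_sumr -big_split.
apply: eq_bigr => i _ /=; rewrite cov_wedge mwedgeDr mwedgeA; congr (_ + _).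
by rewrite !mwedgeA (mwedge_anticomm (con_degree i X) (AkP Y)) mwedgeZl.
Qed.

Lemma frame_conn_wedgel (k l : nat) (X : Ak M k) (Y : Ak M l) Z :
  G (mwedge X Y) Z = mwedge X (G Y Z) + sgn R (k%:Z * l%:Z) *: mwedge Y (G X Z).
Proof.
rewrite -PoszM sgn_nat.
have := @frame_connE (k + l) (MkAk (mwedge_degree (AkP X) (AkP Y))) Z => /= ->.
rewrite !frame_connE !mwedgeZr !mwedge_sumr !scaler_sumr -big_split.
apply: eq_bigr => i _ /=; rewrite fr_con_wedge mwedgeDl scalerDr addrC; congr (_ + _).
  case: k X => [|k] X; first by rewrite (fr_con_degree0 fr i X) !(mwedge0l, mwedge0r) !scaler0.
  rewrite !mwedgeA (mwedge_anticomm (con_degree i X) (AkP Y)) mwedgeZl !scalerA -!exprD.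
  by congr (_ ^+ _ *: _); lia.
rewrite mwedgeZl scalerA mwedgeA -exprD (_ : (k + l).+1 + k = k * 2 + l.+1)%N; last by lia.
by rewrite exprD exprM sqrr_sign mul1r.
Qed.

Definition con0form i E : Ak M 0 := MkAk (@con_degree i 0 E).

Lemma euler_scale E : \sum_i fscale (con0form i E) (e i) = fscale phi E.
Proof.
apply: Ak_eq; rewrite Ak_val_sum fscaleE.
have := fr_euler fr (k := 1) E; rewrite scale1r => <-.
by apply: eq_bigr => i _; rewrite fscaleE mwedgefC.
Qed.

(** One factor [phi] is built into [cov]; the other appears because the frame expands only [phi]
    times E, by [euler_scale]. Neither is differentiated, so both disappear where [phi] is 1. *)
Lemma frame_conn_vec_fun E f : G E f = mwedge phi (br (mwedge phi E) f).
Proof.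
rewrite (@frame_connE 1) sqrrN expr1n scale1r -fscaleE -euler_scale Ak_val_sum.
rewrite (big_morph (fun X => br X f) (fun X Y => brDl hbr X Y f) (br0l hbr f)) mwedge_sumr.
apply: eq_bigr => i _.
by rewrite cov_fun mwedgefA fscaleE (br_funl hbr).
Qed.

(** Expanding [phi] times E in the frame reassembles the contraction terms into [phi] times
    [torsion (e i) E], which restores A from the bracket. *)
Lemma cov_vec i E : cov i E = mwedge phi (A (e i) E).
Proof.
have -> : A (e i) E = br (e i) E + torsion (e i) E :> mvfield M by rewrite addrC subrK.
rewrite mwedgeDr -torsion_scaler -euler_scale /cov; congr (_ + _).
rewrite (big_morph _ (torsion_addr (e i)) (torsion0r (e i))).
apply: eq_bigr => j _; rewrite torsion_scaler -[con j E]/(con0form j E : mvfield M).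
by rewrite -mwedgefC.
Qed.

Lemma frame_conn_vec E E' : G E E' = mwedge phi (mwedge phi (A E E')).
Proof.
rewrite (@frame_connE 1) sqrrN expr1n scale1r -fscaleE -affine_scalel -euler_scale.
rewrite (big_morph (A^~ E') (fun E1 E2 => affine_addl E1 E2 E') (affine0l E')) Ak_val_sum mwedge_sumr.
apply: eq_bigr => i _; rewrite cov_vec affine_scalel mwedgefA.
by [].
Qed.

Lemma frame_conn_at y : phi y = ebas R finset.set0 ->
  conn_at br A y (fun X Z => G X Z y).
Proof.
move=> phi1; split.
- by move=> X X' Z; rewrite frame_conn_addl.
- by move=> X Z Z'; rewrite frame_conn_addr.
- by move=> f Z; rewrite frame_conn_fun0.
- move=> k X f.
  (* Both sides obey the same product rule in X, so the equality spreads from degrees 0 and 1, where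
     it is computed directly. *)
  apply: (@frame_induct _ _ _ fr (fun X => G X f y) (fun X => br X f y)).
  + by move=> X1 X2; rewrite frame_conn_addl.
  + by move=> X1 X2; rewrite (brDl hbr).
  + move=> l Y; rewrite (@frame_conn_wedgel 0) (br_funl hbr) frame_conn_fun0.
    by rewrite mwedge0r scaler0 addr0 !mwE phi1 !wedge1l.
  + by move=> g; rewrite frame_conn_fun0 (schouten_fun hbr).
  + by move=> E; rewrite frame_conn_vec_fun mwE phi1 wedge1l (br_funl hbr (k := 1)) mwE phi1 wedge1l.
  + move=> l E Y EY; rewrite (@frame_conn_wedgel 1) (br_wedge_fun hbr) -PoszM sgn_nat mul1n.
    rewrite !mvD !mvZ !mwE EY frame_conn_vec_fun !mwE phi1 !wedge1l (br_funl hbr (k := 1)).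
    by rewrite mwE phi1 wedge1l.
- by move=> X Y; rewrite frame_conn_vec !mwE phi1 !wedge1l.
- by move=> k l X Y Z; rewrite frame_conn_wedgel.
- by move=> k l X Y Z; rewrite frame_conn_wedger.
Qed.
End WithFrame.

Definition frame_at x : frame M := sval (cid (frame_exists x)).

Lemma frame_at_near x : \forall y \near x, fr_fun (frame_at x) y = ebas R finset.set0.
Proof. exact: svalP (cid (frame_exists x)). Qed.

Lemma frame_at1 x : fr_fun (frame_at x) x = ebas R finset.set0.
Proof. exact: nbhs_singleton (frame_at_near x). Qed.

(** The frame changes with the point. Near x, uniqueness at each y replaces the frame chosen at y by
    the fixed [frame_at x], and the resulting expression is a smooth field. *)
Lemma induced_smooth X Z : smooth_section (fun x => frame_conn (frame_at x) X Z x).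
Proof.
apply: smooth_section_local => x; exists (frame_conn (frame_at x) X Z).
  exact: smooth_mvfield.
apply: filterS (frame_at_near x) => y fy1.
by apply: (conn_at_unique fy1 (frame_conn_at (frame_at1 y)) (frame_conn_at fy1)).
Qed.

Definition induced_conn X Z : mvfield M := mkmv (induced_smooth X Z).

Lemma induced_conn_at x : conn_at br A x (fun X Z => induced_conn X Z x).
Proof. exact: frame_conn_at (frame_at1 x). Qed.

Lemma induced_degree (k l : nat) (X : Ak M k) (Z : Ak M l) :
  induced_conn X Z \in @homogeneous R n M (k%:Z + l%:Z - 1).
Proof.
apply/asboolP => x S Sk.
by have /asboolP := frame_conn_degree (frame_at x) X Z; apply.
Qed.

Lemma induced_of_conn_at (D : mvfield M -> mvfield M -> mvfield M) :
  (forall x, conn_at br A x (fun X Z => D X Z x)) ->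
  (forall (k l : nat) (X : Ak M k) (Z : Ak M l),
    D X Z \in @homogeneous R n M (k%:Z + l%:Z - 1)) ->
  induced_connection br A D.
Proof.
move=> hD Ddeg.
have Dl X X' Z : D (X + X') Z = D X Z + D X' Z.
  by apply: mvfield_eq => x; exact: (ca_addl (hD x)).
have Df f Z : D f Z = 0 by apply: mvfield_eq => x; exact: (ca_fun0 (hD x)).
have Dwl (k l : nat) (X : Ak M k) (Y : Ak M l) Z :
    D (mwedge X Y) Z = mwedge X (D Y Z) + sgn R (k%:Z * l%:Z) *: mwedge Y (D X Z).
  by apply: mvfield_eq => x; exact: (ca_wedgel (hD x)).
have Dwr (k l : nat) (X : Ak M k) (Y : Ak M l) Z :
    D X (mwedge Y Z) = mwedge (D X Y) Z + sgn R ((k%:Z - 1) * l%:Z) *: mwedge Y (D X Z).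
  by apply: mvfield_eq => x; exact: (ca_wedger (hD x)).
have Dfr (k : nat) (X : Ak M k) f : D X f = br X f.
  by apply: mvfield_eq => x; exact: (ca_funr (hD x)).
(* C^oo-linearity in X is not among the pointwise rules: it is the degree 0 case of the product
   rule, as D f = 0, extended by additivity. *)
have funl f X Z : D (mwedge f X) Z = mwedge f (D X Z).
  apply: (@mv_additive_eq _ _ _ _ (fun X => D (mwedge f X) Z) (fun X => mwedge f (D X Z))).
  - by move=> X1 X2; rewrite mwedgeDr Dl.
  - by move=> X1 X2; rewrite -mwedgeDr Dl.
  - by move=> k Y; rewrite (Dwl 0) Df mwedge0r scaler0 addr0.
split=> //; last by move=> X Y; apply: mvfield_eq => x; exact: (ca_agree (hD x)).
split=> //.
- by move=> f X X' Y; rewrite -funl Dl.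
- by move=> X Y Y'; apply: mvfield_eq => x; exact: (ca_addr (hD x)).
- by move=> k X f Y; rewrite (Dwr k 0) Dfr mulr0 sgn_nat expr0 scale1r.
Qed.

Lemma induced_connP : induced_connection br A induced_conn.
Proof. exact: induced_of_conn_at induced_conn_at induced_degree. Qed.

Lemma higher_addl nabla : is_higher_connection br nabla ->
  forall X X' Y, nabla (X + X') Y = nabla X Y + nabla X' Y.
Proof. by move=> h X X' Y; have := hc_linl h (mone M) X X' Y; rewrite !mwedge1l. Qed.

Lemma induced_conn_at_of D x : induced_connection br A D -> conn_at br A x (fun X Z => D X Z x).
Proof.
move=> [h agr wl wr]; split.
- by move=> X X' Z; rewrite (higher_addl h).
- by move=> X Z Z'; rewrite (hc_addr h).
- by move=> f Z; rewrite (hc_fun0 h).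
- by move=> k X f; rewrite (hc_fun h).
- by move=> X Y; rewrite agr.
- by move=> k l X Y Z; rewrite wl.
- by move=> k l X Y Z; rewrite wr.
Qed.

Lemma induced_unique D : induced_connection br A D -> D = induced_conn.
Proof.
move=> hD; apply/funext => X; apply/funext => Z; apply: mvfield_eq => x.
exact: (conn_at_unique (frame_at1 x) (induced_conn_at_of x hD) (induced_conn_at x)).
Qed.

End Induced.

(** * The decomposition *)

Section Decomposition.
Variables (R : realType) (n : nat) (M : smoothManifold R n).
Variables (br : mvfield M -> mvfield M -> mvfield M) (hbr : schouten_bracket br).
Implicit Types (x y : M) (f g : Ak M 0) (A : affine_connection M)
  (F : Efamily M) (nabla : higher_connection br).

Lemma affine_connection_eq A A' : (forall X Y, A X Y = A' X Y) -> A = A'.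
Proof.
case: A A' => [a a1 a2 a3] [b b1 b2 b3] /= E.
have ab : a = b by apply/funext => X; apply/funext => Y.
rewrite -ab in b1 b2 b3 *.
by congr AffineConnection; exact: Prop_irrelevance.
Qed.

Lemma Esection_eq (k l : nat) (S S' : Esection M k l) : (forall X Y, S X Y = S' X Y) -> S = S'.
Proof.
case: S S' => [a a1 a2] [b b1 b2] /= E.
have ab : a = b by apply/funext => X; apply/funext => Y.
rewrite -ab in b1 b2 *.
by congr ESection; exact: Prop_irrelevance.
Qed.

Lemma higher_connection_eq nabla nabla' : (forall X Y, nabla X Y = nabla' X Y) -> nabla = nabla'.
Proof.
case: nabla nabla' => [a a1] [b b1] /= E.
have ab : a = b by apply/funext => X; apply/funext => Y.
rewrite -ab in b1 *.
by congr HigherConnection; exact: Prop_irrelevance.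
Qed.

(** If k = 0 both values vanish, if l = 0 both are the bracket [X, Y], and otherwise the target
    degree exceeds n. *)
Lemma higher_eq_not_admissible (D1 D2 : mvfield M -> mvfield M -> mvfield M) (k l : nat)
    (X : Ak M k) (Y : Ak M l) :
  is_higher_connection br D1 -> is_higher_connection br D2 -> ~~ admissible n k l ->
  D1 X Y = D2 X Y.
Proof.
move=> h1 h2; case: k X => [|k] X; first by rewrite (hc_fun0 h1 X) (hc_fun0 h2 X).
case: l Y => [|l] Y; first by rewrite (hc_fun h1 X Y) (hc_fun h2 X Y).
rewrite /admissible /= -ltnNge => nkl.
have z (D : mvfield M -> mvfield M -> mvfield M) : is_higher_connection br D -> D X Y = 0.
  move=> h; apply: (homogeneous_gt (k := k.+1 + l.+1 - 1)) => //.
  have := hc_degree h X Y; congr (_ \in homogeneous _); lia.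
by rewrite !z.
Qed.

(** * From a higher connection to an affine connection and tensors *)

Section Split.
Variable nabla : higher_connection br.
Let h := hcP nabla.

Lemma restrict_degree (X Y : Ak M 1) : nabla X Y \in @homogeneous R n M 1.
Proof. by have := hc_degree h (k := 1) (l := 1) X Y; rewrite addrK. Qed.

Definition restrict_val (X Y : Ak M 1) : Ak M 1 := MkAk (restrict_degree X Y).

Lemma restrict_linl (f : Ak M 0) (X X' Y : Ak M 1) :
  restrict_val (fscale f X + X') Y = fscale f (restrict_val X Y) + restrict_val X' Y.
Proof. by apply: Ak_eq; rewrite Ak_valD fscaleE /= -(hc_linl h). Qed.

Lemma restrict_addr (X Y Y' : Ak M 1) :
  restrict_val X (Y + Y') = restrict_val X Y + restrict_val X Y'.
Proof. by apply: Ak_eq; rewrite Ak_valD /= -(hc_addr h). Qed.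

Lemma restrict_leibniz (f : Ak M 0) (X Y : Ak M 1) x :
  restrict_val X (fscale f Y) x = wedge (lie X f x) (Y x) + fscale f (restrict_val X Y) x.
Proof.
by rewrite -(schouten_lie hbr) [LHS](congr1 (fun Z : mvfield M => Z x) (hc_leibniz h (k := 1) X f Y)).
Qed.

Definition restriction : affine_connection M :=
  AffineConnection restrict_linl restrict_addr restrict_leibniz.

Notation D := (induced_conn hbr restriction).
Let hD : is_higher_connection br D := induced_hc (induced_connP hbr restriction).

Lemma difference_degree (k l : nat) (X : Ak M k) (Y : Ak M l) :
  nabla X Y - D X Y \in @homogeneous R n M (k%:Z + l%:Z - 1).
Proof. by rewrite rpredB //; [exact: (hc_degree h)|exact: (hc_degree hD)]. Qed.

Definition difference_val (k l : nat) (X : Ak M k) (Y : Ak M l) : Ak M (k%:Z + l%:Z - 1) :=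
  MkAk (difference_degree X Y).

Lemma difference_linl (k l : nat) (f : Ak M 0) (X X' : Ak M k) (Y : Ak M l) :
  difference_val (fscale f X + X') Y = fscale f (difference_val X Y) + difference_val X' Y.
Proof.
apply: Ak_eq; rewrite Ak_valD fscaleE /= (hc_linl h) (hc_linl hD).
by rewrite mwedgeDr mwedgeNr opprD addrACA.
Qed.

(** The derivative term [X, f] /\ Y is the same for every higher connection and cancels in the
    difference. *)
Lemma difference_linr (k l : nat) (f : Ak M 0) (X : Ak M k) (Y Y' : Ak M l) :
  difference_val X (fscale f Y + Y') = fscale f (difference_val X Y) + difference_val X Y'.
Proof.
apply: Ak_eq; rewrite Ak_valD fscaleE /= (hc_addr h) (hc_addr hD).
rewrite (hc_leibniz h) (hc_leibniz hD) mwedgeDr mwedgeNr opprD addrACA; congr (_ + _).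
by rewrite opprD addrACA subrr add0r.
Qed.

Definition difference : Efamily M :=
  fun k l _ => ESection (@difference_linl k l) (@difference_linr k l).

Lemma split_F11 : F11_zero difference.
Proof.
move=> hadm X Y; apply: Ak_eq => /=.
by rewrite (induced_agree (induced_connP hbr restriction)) subrr.
Qed.

Lemma split_decomposition : decomposition br nabla restriction difference.
Proof.
exists D; first exact: induced_connP.
move=> k l X Y; split=> [hadm|nadm]; first by rewrite /= addrC subrK.
exact: higher_eq_not_admissible nadm.
Qed.

Lemma split_unique A F : F11_zero F -> decomposition br nabla A F ->
  (restriction, difference) = (A, F).
Proof.
move=> F0 [D' hD' dec].
have EA : restriction = A.
  apply: affine_connection_eq => X Y; apply: Ak_eq => /=.
  rewrite -(induced_agree hD'); have [dec1 dec2] := dec 1%N 1%N X Y.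
  (* The pair (1, 1) is not admissible exactly when n = 0; then there is no correction term, so A is
     forced in either case. *)
  have [hadm|/dec2 ->//] := boolP (admissible n 1 1).
  by rewrite (dec1 hadm) F0 addr0.
congr (_, _) => //; apply: functional_extensionality_dep => k.
apply: functional_extensionality_dep => l; apply/funext => hadm.
apply: Esection_eq => X Y; apply: Ak_eq => /=.
have [/(_ hadm) -> _] := dec k l X Y.
by rewrite EA (induced_unique hbr hD') addrC addKr.
Qed.
End Split.

(** * From an affine connection and tensors to a higher connection *)

Section Combine.
Variables (A : affine_connection M) (F : Efamily M) (F0 : F11_zero F).
Notation D := (induced_conn hbr A).
Let hD : is_higher_connection br D := induced_hc (induced_connP hbr A).

(** Total in k and l, so that sums over all degrees can be formed without carrying admissibility
    proofs. *)
Definition Fext (k l : nat) (X : Ak M k) (Y : Ak M l) : mvfield M :=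
  if pselect (admissible n k l) is left hadm then F hadm X Y else 0.

Lemma Fext_adm (k l : nat) (hadm : admissible n k l) X Y : Fext X Y = F hadm X Y.
Proof.
rewrite /Fext; case: pselect => [h|/(_ hadm)//].
by rewrite (bool_irrelevance h hadm).
Qed.

Lemma Fext_not_adm (k l : nat) (X : Ak M k) (Y : Ak M l) : ~~ admissible n k l -> Fext X Y = 0.
Proof. by move=> nadm; rewrite /Fext; case: pselect => // h; rewrite h in nadm. Qed.

Lemma Fext_linl (k l : nat) (f : Ak M 0) (X X' : Ak M k) (Y : Ak M l) :
  Fext (fscale f X + X') Y = mwedge f (Fext X Y) + Fext X' Y.
Proof.
rewrite /Fext; case: pselect => [h|_]; last by rewrite mwedge0r addr0.
by rewrite Esection_linl Ak_valD fscaleE.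
Qed.

Lemma Fext_linr (k l : nat) (f : Ak M 0) (X : Ak M k) (Y Y' : Ak M l) :
  Fext X (fscale f Y + Y') = mwedge f (Fext X Y) + Fext X Y'.
Proof.
rewrite /Fext; case: pselect => [h|_]; last by rewrite mwedge0r addr0.
by rewrite Esection_linr Ak_valD fscaleE.
Qed.

Lemma Fext0l (k l : nat) (Y : Ak M l) : Fext (0 : Ak M k) Y = 0.
Proof.
have := Fext_linl (mone M) (0 : Ak M k) 0 Y.
by rewrite fscale1 mwedge1l addr0 => /eqP; rewrite -subr_eq subrr eq_sym => /eqP.
Qed.

Lemma Fext0r (k l : nat) (X : Ak M k) : Fext X (0 : Ak M l) = 0.
Proof.
have := Fext_linr (mone M) X (0 : Ak M l) 0.
by rewrite fscale1 mwedge1l addr0 => /eqP; rewrite -subr_eq subrr eq_sym => /eqP.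
Qed.

Lemma Fext_degree (k l : nat) (X : Ak M k) (Y : Ak M l) :
  Fext X Y \in @homogeneous R n M (k%:Z + l%:Z - 1).
Proof. by rewrite /Fext; case: pselect => [h|_]; [exact: AkP|exact: rpred0]. Qed.

(** The extension of F to inhomogeneous fields; degrees above n contain only the zero field. *)
Definition Fsum (X Y : mvfield M) : mvfield M :=
  \sum_(k < n.+1) \sum_(l < n.+1) Fext (mgr k X) (mgr l Y).

Lemma Fsum_linl f (X X' Y : mvfield M) :
  Fsum (mwedge f X + X') Y = mwedge f (Fsum X Y) + Fsum X' Y.
Proof.
rewrite /Fsum mwedge_sumr -big_split; apply: eq_bigr => k _ /=.
rewrite mwedge_sumr -big_split; apply: eq_bigr => l _ /=.
by rewrite mgr_flin Fext_linl.
Qed.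

Lemma Fsum_linr f (X Y Y' : mvfield M) :
  Fsum X (mwedge f Y + Y') = mwedge f (Fsum X Y) + Fsum X Y'.
Proof.
rewrite /Fsum mwedge_sumr -big_split; apply: eq_bigr => k _ /=.
rewrite mwedge_sumr -big_split; apply: eq_bigr => l _ /=.
by rewrite mgr_flin Fext_linr.
Qed.

Lemma FsumE (k l : nat) (X : Ak M k) (Y : Ak M l) : Fsum X Y = Fext X Y.
Proof.
have [kn|nk] := ltnP k n.+1; last first.
  (* For k > n, any l > 0 gives k + l - 1 > n, so (k, l) is never admissible. *)
  rewrite Fext_not_adm; last by apply/negP => /and3P[]; lia.
  rewrite /Fsum big1 // => i _; rewrite big1 // => j _.
  rewrite mgr_other ?Fext0l //; apply: contraTneq nk => ->; rewrite -ltnNge; exact: ltn_ord.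
have [ln|nl] := ltnP l n.+1; last first.
  rewrite Fext_not_adm; last by apply/negP => /and3P[]; lia.
  rewrite /Fsum big1 // => i _; rewrite big1 // => j _.
  rewrite (@mgr_other _ _ _ _ _ Y) ?Fext0r //; apply: contraTneq nl => ->.
  by rewrite -ltnNge; exact: ltn_ord.
rewrite /Fsum (@sum_only _ _ _ (Ordinal kn)) => [|i ik]; last first.
  rewrite big1 // => j _; rewrite mgr_other ?Fext0l //.
  by apply: contraNneq ik => ki; apply/eqP/val_inj.
rewrite (@sum_only _ _ _ (Ordinal ln)) => [|j jl]; last first.
  rewrite (@mgr_other _ _ _ _ _ Y) ?Fext0r //.
  by apply: contraNneq jl => lj; apply/eqP/val_inj.
by rewrite (mgr_id X) (mgr_id Y).
Qed.

(** The added term is C^oo-bilinear and vanishes when either degree is 0: it contributes no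
    derivative to the Leibniz rule and nothing when one argument is a function. *)
Lemma combine_proof : is_higher_connection br (fun X Y => D X Y + Fsum X Y).
Proof.
split.
- by move=> k l X Y; rewrite FsumE rpredD //; [exact: (hc_degree hD)|exact: Fext_degree].
- by move=> f X X' Y; rewrite (hc_linl hD) Fsum_linl mwedgeDr addrACA.
- move=> X Y Y'; have := Fsum_linr (mone M) X Y Y'; rewrite !mwedge1l => ->.
  by rewrite (hc_addr hD) addrACA.
- move=> k X f; rewrite (FsumE X (l := 0) f) Fext_not_adm ?addr0; first exact: (hc_fun hD).
  by rewrite /admissible andbF.
- move=> k X f Y; have := Fsum_linr f X Y 0; rewrite addr0 => ->.
  have -> : Fsum X 0 = 0 by rewrite /Fsum big1 // => i _; rewrite big1 // => j _; rewrite mgr0 Fext0r.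
  by rewrite (hc_leibniz hD) addr0 mwedgeDr addrA.
- move=> f X; rewrite (hc_fun0 hD) add0r /Fsum big1 // => i _; rewrite big1 // => j _.
  have [->|i0] := eqVneq (i : nat) 0%N; first by rewrite Fext_not_adm.
  by rewrite (mgr_other (l := 0) f) ?Fext0l // eq_sym.
Qed.

Definition combine : higher_connection br := HigherConnection combine_proof.

Lemma combine_decomposition : decomposition br combine A F.
Proof.
exists D; first exact: induced_connP.
move=> k l X Y; split=> [hadm|nadm] /=; rewrite FsumE.
  by rewrite (Fext_adm hadm).
by rewrite Fext_not_adm // addr0.
Qed.

Lemma decomposition_unique (nabla nabla' : higher_connection br) :
  decomposition br nabla A F -> decomposition br nabla' A F -> nabla = nabla'.
Proof.
move=> [D1 hD1 dec1] [D2 hD2 dec2]; apply: higher_connection_eq => X Y.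
apply: (@mv_additive_eq _ _ _ _ (nabla^~ Y) (nabla'^~ Y)).
- by move=> X1 X2; exact: (higher_addl (hcP nabla)).
- by move=> X1 X2; exact: (higher_addl (hcP nabla')).
move=> k {}X; apply: (@mv_additive_eq _ _ _ _ (nabla X) (nabla' X)).
- exact: (hc_addr (hcP nabla)).
- exact: (hc_addr (hcP nabla')).
move=> l {}Y; have [a1 b1] := dec1 k l X Y; have [a2 b2] := dec2 k l X Y.
rewrite (induced_unique hbr hD1) in a1 b1; rewrite (induced_unique hbr hD2) in a2 b2.
have [hadm|nadm] := boolP (admissible n k l).
  by rewrite (a1 hadm) (a2 hadm).
by rewrite (b1 nadm) (b2 nadm).
Qed.
End Combine.
End Decomposition.

Theorem theorem3p9 (R : realType) (n : nat) (M : smoothManifold R n)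
    (br : mvfield M -> mvfield M -> mvfield M) (hbr : schouten_bracket br) :
  (forall nabla : higher_connection br,
     exists! p : affine_connection M * Efamily M,
       F11_zero p.2 /\ decomposition br nabla p.1 p.2) /\
  (forall (A : affine_connection M) (F : Efamily M), F11_zero F ->
     exists! nabla : higher_connection br, decomposition br nabla A F) /\
  (exists Phi : higher_connection br -> connection_data M,
     bijective Phi /\
     forall nabla : higher_connection br,
       decomposition br nabla (sval (Phi nabla)).1 (sval (Phi nabla)).2).
Proof.
split; [|split].
- move=> nabla; exists (restriction hbr nabla, difference hbr nabla); split.
    by split; [exact: split_F11|exact: split_decomposition].
  by move=> [A F] /= [F0 dec]; exact: split_unique.
- move=> A F F0; exists (combine hbr A F); split; first exact: combine_decomposition.
  by move=> nabla; exact: decomposition_unique (combine_decomposition hbr A F).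
- exists (fun nabla => exist (fun p : affine_connection M * Efamily M => F11_zero p.2)
    (restriction hbr nabla, difference hbr nabla) (split_F11 hbr nabla)).
  split; last by move=> nabla; exact: split_decomposition.
  exists (fun p : connection_data M => combine hbr (sval p).1 (sval p).2) => [nabla|].
    exact: decomposition_unique (combine_decomposition _ _ _) (split_decomposition _ _).
  move=> [[A F] /= F0].
  (* The second component is a proof of a proposition, so equality of the pairs is enough. *)
  by apply: eq_exist; exact: split_unique F0 (combine_decomposition hbr A F).
Qed.
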